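(* Let $$\mathcal{M}(n)=\frac12\prod_{\substack{p\equiv3\ (\mathrm{mod}\ 4)\\ p\le n}}(1+p^{-1})^{-1},\qquad \mathcal{L}(n)=\frac{\beta}{\sqrt{\log n}},$$ where $\beta=\frac{1}{\sqrt2}\prod_{p\equiv3\ (\mathrm{mod}\ 4)}(1-p^{-2})^{-1/2}$ is the Landau–Ramanujan constant. Then $y(n)=\mathcal{M}(n)/\mathcal{L}(n)$ converges as $n\to\infty$ and $$\lim_{n\to\infty}\frac{\mathcal{M}(n)}{\mathcal{L}(n)}=\frac12\sqrt{\frac{\pi}{e^{\gamma}}},$$ where $\gamma$ is Euler's constant.
   Context: $p$ ranges over primes. $\mathcal{M}(n)=\prod_{p\le n}Med(p)$ is the product of the limiting densities of elements representable as a sum of two squares in $\mathbb{Z}/p^k\mathbb{Z}$ ($k\to\infty$). *)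

(* Defs.v *)
From Stdlib Require Import Reals ZArith Znumtheory Arith.
Open Scope R_scope.

Fixpoint prod_upto (f : nat -> R) (n : nat) : R :=
  match n with
  | O => f O
  | S m => prod_upto f m * f (S m)
  end.

Definition is_prime3mod4 (p : nat) : bool :=
  (if prime_dec (Z.of_nat p) then true else false) && Nat.eqb (Nat.modulo p 4) 3.

Definition factor3 (g : R -> R) (p : nat) : R :=
  if is_prime3mod4 p then g (INR p) else 1.

Definition M (n : nat) : R :=
  / 2 * prod_upto (factor3 (fun x => / (1 + / x))) n.

Definition beta_partial (n : nat) : R :=
  / sqrt 2 * prod_upto (factor3 (fun x => / sqrt (1 - / (x ^ 2)))) n.

Definition L (beta : R) (n : nat) : R := beta / sqrt (ln (INR n)).

Definition euler_partial (n : nat) : R :=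
  sum_f_R0 (fun k => / INR (S k)) n - ln (INR (S n)).

(* Main.v *)
(* The limit comes from a Tauberian argument at s = 1, without any
   estimate on the distribution of primes. By the Euler products of the odd part of
   zeta(s) and of L(s, chi_4), their quotient is the product of
   (1 + p^-s) / (1 - p^-s) over p = 3 mod 4. As s = 1 + d tends to 1+, the quotient
   is asymptotic to (1 / (2 d)) / (PI / 4), so the sum of phi(1/p) p^-d, where
   phi(t) = ln ((1 + t) / (1 - t)), is ln (1 / d) + ln (2 / PI) + o(1).
   The sum of (1/m) exp(-d m) is likewise ln (1 / d) + o(1). Both are Laplace transforms
   of positive measures, and a Karamata-style sandwich of the indicator of [0, 1] between
   polynomials in exp(-u) shows that the partial sums of the two measures have the same
   asymptotics up to the additive constants above. For the second measure the partial
   sums are the harmonic numbers, which is how Euler's constant enters. *)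
From Coquelicot Require Import Coquelicot.
Require Import Defs.
From Stdlib Require Import Reals ZArith Znumtheory Arith Bool Lra Lia.
Open Scope R_scope.

(** * Limits of series *)

(** Since [/ (1 + t)] is [/ sqrt (1 - t ^ 2)] times [sqrt ((1 - t) / (1 + t))], the ratio
    [M n / L beta n] is [beta_partial n / beta * (sqrt 2 / 2)] times the square root of
    [ln n / exp S], where [S] is the sum of phi(1/p) over p <= n. The product in beta thus cancels
    in the limit, and [S] is needed up to o(1): it is ln ln n + gamma + ln (2 / PI). An o(1) error
    is finer than what Karamata's theorem usually gives, and both measures have infinite mass: the
    integral of a test polynomial f diverges as d tends to 0 unless f(1) = 0. Subtracting f(1) (c -
    ln d) leaves a limit that depends on f alone, so it never has to be computed. The sandwich error
    is measured by x (1 - x) for the same reason: the factor x makes the sums converge, and 1 - x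
    removes the divergence at d = 0. *)

Lemma is_lim_seq_eps (u : nat -> R) (l : R) :
  is_lim_seq u l <->
  forall eps, 0 < eps -> exists N, forall n, (N <= n)%nat -> Rabs (u n - l) < eps.
Proof.
rewrite is_lim_seq_Reals; split.
- intros H eps He; exact (H eps He).
- intros H eps He; exact (H eps He).
Qed.

Lemma is_lim_seq_minus_R (u v : nat -> R) (a b : R) :
  is_lim_seq u a -> is_lim_seq v b -> is_lim_seq (fun n => u n - v n) (a - b).
Proof. intros Hu Hv; apply is_lim_seq_minus'; assumption. Qed.

Lemma ex_series_tail_lim (b : nat -> R) :
  ex_series b -> is_lim_seq (fun N => Series (fun k => b (S N + k)%nat)) 0.
Proof.
intros Hb.
apply is_lim_seq_ext with (fun N => Series b - sum_f_R0 b N).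
- intros N; rewrite (Series_incr_n b (S N)); [simpl pred; ring | lia | exact Hb].
- replace (Finite 0) with (Finite (Series b - Series b)) by (f_equal; ring).
  apply is_lim_seq_minus_R; [apply is_lim_seq_const |].
  apply is_lim_seq_ext with (sum_n b); [intros n; apply sum_n_Reals |].
  exact (Series_correct b Hb).
Qed.

Lemma is_lim_seq_sum_f_R0 (d : nat -> nat -> R) (l : nat -> R) (N : nat) :
  (forall n, is_lim_seq (fun k => d k n) (l n)) ->
  is_lim_seq (fun k => sum_f_R0 (d k) N) (sum_f_R0 l N).
Proof.
intros H; induction N as [|N IH]; simpl; [apply H |].
apply is_lim_seq_plus'; [exact IH | apply H].
Qed.

Lemma ex_series_dominated (a b : nat -> R) :
  (forall n, Rabs (a n) <= b n) -> ex_series b -> ex_series a.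
Proof. intros H Hb; exact (ex_series_le a b H Hb). Qed.

(** Dominated convergence for series: past some [N] the tail of [2 * b] bounds the difference
    uniformly in [k], and the finitely many terms before it tend to 0. *)
Lemma tannery (a : nat -> nat -> R) (l b : nat -> R) :
  (forall k n, Rabs (a k n) <= b n) -> ex_series b ->
  (forall n, is_lim_seq (fun k => a k n) (l n)) ->
  is_lim_seq (fun k => Series (a k)) (Series l).
Proof.
intros Hab Hb Hl.
assert (Hlb : forall n, Rabs (l n) <= b n).
{ intros n.
  apply (is_lim_seq_le (fun k => Rabs (a k n)) (fun _ => b n) (Rabs (l n)) (b n)).
  - intros k; apply Hab.
  - exact (is_lim_seq_abs _ _ (Hl n)).
  - apply is_lim_seq_const. }
set (d := fun k n => Rabs (a k n - l n)).
assert (Hd : forall k n, 0 <= d k n <= 2 * b n).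
{ intros k n; split; [apply Rabs_pos |].
  generalize (Hab k n) (Hlb n) (Rabs_triang (a k n) (- l n)).
  rewrite Rabs_Ropp; unfold d, Rminus; lra. }
assert (Hb2 : ex_series (fun n => 2 * b n)) by exact (ex_series_scal 2 b Hb).
assert (Hde : forall k, ex_series (d k)).
{ intros k; apply ex_series_dominated with (fun n => 2 * b n); [| exact Hb2].
  intros n; rewrite Rabs_pos_eq; apply Hd. }
assert (Hdl : forall n, is_lim_seq (fun k => d k n) 0).
{ intros n; replace (Finite 0) with (Rbar_abs (Finite (l n - l n))).
  - apply is_lim_seq_abs, is_lim_seq_minus_R; [apply Hl | apply is_lim_seq_const].
  - simpl; rewrite Rminus_diag, Rabs_R0; reflexivity. }
apply is_lim_seq_eps; intros eps He.
destruct (proj1 (is_lim_seq_eps _ _) (ex_series_tail_lim _ Hb2) (eps / 2)) as [N HN];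
  [lra |].
specialize (HN N (Nat.le_refl N)).
assert (Hs := is_lim_seq_sum_f_R0 d (fun _ => 0) N Hdl).
rewrite sum_eq_R0 in Hs by reflexivity.
destruct (proj1 (is_lim_seq_eps _ _) Hs (eps / 2)) as [K HK]; [lra |].
exists K; intros k Hk; specialize (HK k Hk).
rewrite Rminus_0_r in HN, HK.
assert (Hak : ex_series (a k)) by (apply ex_series_dominated with b; auto).
assert (Hle : ex_series l) by (apply ex_series_dominated with b; auto).
rewrite <- Series_minus by assumption.
apply Rle_lt_trans with (Series (d k)); [apply Series_Rabs, Hde |].
rewrite (Series_incr_n (d k) (S N)); [simpl pred | lia | apply Hde].
assert (Series (fun j => d k (S N + j)%nat) <= Series (fun j => 2 * b (S N + j)%nat)).
{ apply Series_le; [intros j; apply Hd |].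
  exact (proj1 (ex_series_incr_n (fun n => 2 * b n) (S N)) Hb2). }
generalize (Rle_abs (sum_f_R0 (d k) N))
  (Rle_abs (Series (fun j => 2 * b (S N + j)%nat))); lra.
Qed.

(** * A Tauberian theorem *)

(** The right-hand limit at 0, phrased with sequences so that [tannery] and the lemmas on
    [is_lim_seq] apply directly. *)
Definition at_zero (Phi : R -> R) (l : R) : Prop :=
  forall u : nat -> R, (forall n, 0 < u n) -> is_lim_seq u 0 ->
  is_lim_seq (fun n => Phi (u n)) l.

Definition laplace (w lam : nat -> R) (f : R -> R) (d : R) : R :=
  Series (fun n => w n * f (exp (- (d * lam n)))).

(** A positive measure with mass [w n] at the point [lam n], whose Laplace transform at [d] is ln (1
    / d) + [c] + o(1). *)
Record log_laplace (w lam : nat -> R) (c : R) : Prop := {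
  ll_w : forall n, 0 <= w n;
  ll_pos : forall n, 0 < lam n;
  ll_incr : forall m n, (m <= n)%nat -> lam m <= lam n;
  ll_infty : is_lim_seq lam p_infty;
  ll_ex : forall d, 0 < d -> ex_series (fun n => w n * exp (- (d * lam n)));
  ll_lim : at_zero (fun d => laplace w lam (fun x => x) d + ln d) c }.

(* The constant [kappa] depends on [f] only, not on the measure. *)
Definition regularizable (f : R -> R) : Prop :=
  exists kappa : R, forall w lam c, log_laplace w lam c ->
  (forall d, 0 < d -> ex_series (fun n => w n * f (exp (- (d * lam n))))) /\
  at_zero (fun d => laplace w lam f d + f 1 * (ln d - c)) kappa.

Lemma exp_pow (x : R) (k : nat) : exp x ^ k = exp (INR k * x).
Proof.
induction k as [|k IH]; [simpl; rewrite Rmult_0_l, exp_0; reflexivity |].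
rewrite S_INR; simpl; rewrite IH, <- exp_plus; f_equal; ring.
Qed.

Lemma is_lim_seq_scal_0 (a : R) (u : nat -> R) :
  is_lim_seq u 0 -> is_lim_seq (fun n => a * u n) 0.
Proof.
intros Hu; replace (Finite 0) with (Rbar_mult a 0).
- apply is_lim_seq_scal_l, Hu.
- simpl; rewrite Rmult_0_r; reflexivity.
Qed.

Lemma at_zero_scal (Phi : R -> R) (l s : R) :
  0 < s -> at_zero Phi l -> at_zero (fun d => Phi (s * d)) l.
Proof.
intros Hs H u Hu Hu0; apply (H (fun n => s * u n)).
- intros n; apply Rmult_lt_0_compat; auto.
- apply is_lim_seq_scal_0, Hu0.
Qed.

Lemma regularizable_ext (f g : R -> R) :
  (forall x, f x = g x) -> regularizable f -> regularizable g.
Proof.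
intros E [k Hk]; exists k; intros w lam c Hs; destruct (Hk w lam c Hs) as [H1 H2].
split.
- intros d Hd; apply ex_series_ext with (2 := H1 d Hd).
  intros n; rewrite E; reflexivity.
- intros u Hu Hu0; apply is_lim_seq_ext with (2 := H2 u Hu Hu0).
  intros n; rewrite E; unfold laplace; f_equal; apply Series_ext.
  intros m; rewrite E; reflexivity.
Qed.

(** Raising [exp (- (d * lam n))] to the power [k] replaces [d] by [k * d], which shifts [ln d] by
    [ln k]. The power 0 is excluded because the total mass is infinite. *)
Lemma regularizable_pow (k : nat) : (1 <= k)%nat -> regularizable (fun x => x ^ k).
Proof.
intros Hk; exists (- ln (INR k)); intros w lam c Hs.
assert (Hk0 : 0 < INR k) by (apply lt_0_INR; lia).
assert (E : forall d n, w n * exp (- (INR k * d * lam n)) = w n * exp (- (d * lam n)) ^ k).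
{ intros d n; rewrite exp_pow; do 2 f_equal; ring. }
split.
- intros d Hd; apply ex_series_ext with (1 := E d).
  apply (ll_ex _ _ _ Hs), Rmult_lt_0_compat; assumption.
- intros u Hu Hu0.
  apply is_lim_seq_ext with
    (fun n => laplace w lam (fun x => x) (INR k * u n) + ln (INR k * u n) - (c + ln (INR k))).
  + intros n; rewrite ln_mult, pow1 by auto.
    unfold laplace; rewrite (Series_ext _ _ (E (u n))); ring.
  + replace (- ln (INR k)) with (c - (c + ln (INR k))) by ring.
    apply is_lim_seq_minus_R; [| apply is_lim_seq_const].
    exact (at_zero_scal _ _ _ Hk0 (ll_lim _ _ _ Hs) u Hu Hu0).
Qed.

Lemma regularizable_lin (a b : R) (f g : R -> R) :
  regularizable f -> regularizable g -> regularizable (fun x => a * f x + b * g x).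
Proof.
intros [k Hk] [l Hl]; exists (a * k + b * l); intros w lam c Hs.
destruct (Hk w lam c Hs) as [Hf Lf], (Hl w lam c Hs) as [Hg Lg].
assert (E : forall d n, a * (w n * f (exp (- (d * lam n)))) + b * (w n * g (exp (- (d * lam n))))
  = w n * (a * f (exp (- (d * lam n))) + b * g (exp (- (d * lam n))))) by (intros; ring).
assert (Xf : forall d, 0 < d -> ex_series (fun n => a * (w n * f (exp (- (d * lam n))))))
  by (intros d Hd; exact (ex_series_scal a _ (Hf d Hd))).
assert (Xg : forall d, 0 < d -> ex_series (fun n => b * (w n * g (exp (- (d * lam n))))))
  by (intros d Hd; exact (ex_series_scal b _ (Hg d Hd))).
split.
- intros d Hd; apply ex_series_ext with (1 := E d).
  exact (ex_series_plus _ _ (Xf d Hd) (Xg d Hd)).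
- intros u Hu Hu0.
  apply is_lim_seq_ext with
    (fun n => a * (laplace w lam f (u n) + f 1 * (ln (u n) - c)) +
              b * (laplace w lam g (u n) + g 1 * (ln (u n) - c))).
  + intros n; unfold laplace; rewrite <- (Series_ext _ _ (E (u n))).
    rewrite Series_plus, !Series_scal_l by auto; ring.
  + apply is_lim_seq_plus'.
    * exact (is_lim_seq_scal_l _ a _ (Lf u Hu Hu0)).
    * exact (is_lim_seq_scal_l _ b _ (Lg u Hu Hu0)).
Qed.

Lemma regularizable_pow_mul (n : nat) : forall m k, (1 <= k)%nat ->
  regularizable (fun x => x ^ k * (1 - x ^ n) ^ m).
Proof.
induction m as [|m IH]; intros k Hk.
- apply regularizable_ext with (2 := regularizable_pow k Hk); intros x; simpl; ring.
- apply regularizable_ext with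
    (2 := regularizable_lin 1 (-1) _ _ (IH k Hk) (IH (k + n)%nat ltac:(lia))).
  intros x; rewrite pow_add; simpl; ring.
Qed.

(** Induction on [m]: consecutive polynomials differ by [x ^ n * (1 - x ^ n) ^ m], which has no
    constant term. *)
Lemma regularizable_bump (n m : nat) : (1 <= n)%nat ->
  regularizable (fun x => 1 - (1 - x ^ n) ^ m).
Proof.
intros Hn; induction m as [|m IH].
- apply regularizable_ext with
    (2 := regularizable_lin 0 0 _ _ (regularizable_pow n Hn) (regularizable_pow n Hn)).
  intros x; simpl; ring.
- apply regularizable_ext with
    (2 := regularizable_lin 1 1 _ _ IH (regularizable_pow_mul n m n Hn)).
  intros x; simpl; ring.
Qed.

(** * Step polynomials in [exp (- t)] *)

Lemma pow_one_minus_ge (m : nat) (y : R) : 0 <= y <= 1 -> 1 - INR m * y <= (1 - y) ^ m.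
Proof.
intros Hy; induction m as [|m IH]; [simpl; lra |].
rewrite S_INR; simpl.
assert (0 <= INR m * y) by (apply Rmult_le_pos; [apply pos_INR | lra]).
nra.
Qed.

Lemma pow_one_minus_le_exp (m : nat) (y : R) : 0 <= y <= 1 -> (1 - y) ^ m <= exp (- (INR m * y)).
Proof.
intros Hy; replace (- (INR m * y)) with (INR m * - y) by ring; rewrite <- exp_pow.
apply pow_incr; split; [lra |].
generalize (exp_ineq1_le (- y)); lra.
Qed.

Lemma pow_unit_interval (n : nat) (y : R) : 0 <= y <= 1 -> 0 <= y ^ n <= 1.
Proof.
intros Hy; induction n as [|n IH]; simpl; [lra | nra].
Qed.

Lemma INR_pow2 (n : nat) : INR (2 ^ n) = exp (INR n * ln 2).
Proof.
rewrite pow_INR, <- exp_pow, exp_ln by lra; reflexivity.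
Qed.

Lemma exp_sqr_le (y : R) : 0 <= y -> y ^ 2 / 4 <= exp y.
Proof.
intros Hy; replace y with (y / 2 + y / 2) at 2 by field; rewrite exp_plus.
generalize (exp_ineq1_le (y / 2)); nra.
Qed.

Lemma exp_opp_le_inv (v : R) : 0 < v -> exp (- v) <= / v.
Proof.
intros Hv; rewrite exp_Ropp; apply Rinv_le_contravar; [lra |].
generalize (exp_ineq1_le v); lra.
Qed.

Lemma exp_opp_ln2 : exp (- ln 2) = / 2.
Proof. rewrite exp_Ropp, exp_ln by lra; reflexivity. Qed.

Lemma exp_le (x y : R) : x <= y -> exp x <= exp y.
Proof. intros [H| ->]; [left; apply exp_increasing, H | right; reflexivity]. Qed.

Lemma ln2_pos : 0 < ln 2.
Proof. rewrite <- ln_1; apply ln_increasing; lra. Qed.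

(* With [x = exp (- t)], a smooth step from 1 to 0 at [t = ln 2], of width about [1 / n]. *)
Definition bump (n : nat) (x : R) : R := 1 - (1 - x ^ n) ^ (2 ^ n).

Lemma bump_bounds (n : nat) (x : R) : 0 <= x <= 1 -> 0 <= bump n x <= 1.
Proof.
intros Hx; unfold bump.
generalize (pow_unit_interval n x Hx); intros Hn.
generalize (pow_unit_interval (2 ^ n) (1 - x ^ n)); lra.
Qed.

Lemma bump_1 (n : nat) : bump n 1 = 1.
Proof.
unfold bump; rewrite pow1, Rminus_diag, pow_i; [ring |].
assert (2 ^ n <> 0)%nat by (apply Nat.pow_nonzero; lia); lia.
Qed.

Lemma exp_neg_bounds (t : R) : 0 <= t -> 0 < exp (- t) <= 1.
Proof.
intros Ht; split; [apply exp_pos | rewrite <- exp_0; apply exp_le; lra].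
Qed.

(** Bernoulli's inequality bounds the bump by [2 ^ n * exp (- (n * theta * t))]. For [t >= ln 2]
    this decays at least like [exp (- t)], and the margin [theta > 1] leaves a factor that is small
    for large [n]. Finally [1 - exp (- t)] is at least 1/2. *)
Lemma bump_small (theta eps : R) (n : nat) (t : R) :
  1 < theta -> 0 < eps -> (1 <= n)%nat ->
  exp (- ((INR n * (theta - 1) - 1) * ln 2)) <= eps / 2 ->
  ln 2 <= t -> bump n (exp (- (theta * t))) <= eps * (exp (- t) * (1 - exp (- t))).
Proof.
intros Hth He Hn Hs Ht.
assert (H2 := ln2_pos).
assert (Hn1 : 1 <= INR n) by (apply (le_INR 1 n); lia).
assert (Hz := exp_neg_bounds (theta * t) ltac:(apply Rmult_le_pos; lra)).
assert (Hx : exp (- t) <= / 2) by (rewrite <- exp_opp_ln2; apply exp_le; lra).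
apply Rle_trans with (exp (- t) * (eps / 2)).
2: { generalize (exp_pos (- t)) (Rmult_le_compat_l (exp (- t) * eps) (1 / 2) (1 - exp (- t)));
     intros P Q; assert (0 <= exp (- t) * eps) by nra; lra. }
unfold bump.
assert (0 <= exp (- (theta * t)) ^ n <= 1)
  by (apply pow_unit_interval; lra).
generalize (pow_one_minus_ge (2 ^ n) _ H); intros B.
apply Rle_trans with (INR (2 ^ n) * exp (- (theta * t)) ^ n); [lra |].
rewrite INR_pow2, exp_pow, <- exp_plus.
apply Rle_trans with (exp (- t) * exp (- ((INR n * (theta - 1) - 1) * ln 2))).
- rewrite <- exp_plus; apply exp_le.
  assert (0 <= (INR n * theta - 1) * (t - ln 2)) by (apply Rmult_le_pos; nra).
  nra.
- apply Rmult_le_compat_l; [left; apply exp_pos | exact Hs].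
Qed.

(** The quantity to bound is [(1 - z ^ n) ^ (2 ^ n)] with [z = exp (- t / theta)]. The right side
    vanishes at [t = 0], so smallness alone does not suffice: one factor is kept to produce [1 - x],
    and the other [2 ^ n - 1] factors supply the smallness. *)
Lemma bump_large (theta eps : R) (n : nat) (t : R) :
  1 < theta -> 0 < eps -> (1 <= n)%nat ->
  16 / ((ln 2 * (1 - / theta)) ^ 2 * eps) <= INR n ->
  0 <= t <= ln 2 -> 1 - bump n (exp (- (/ theta * t))) <= eps * (exp (- t) * (1 - exp (- t))).
Proof.
intros Hth He Hn Hs Ht.
assert (H2 := ln2_pos).
assert (Hn1 : 1 <= INR n) by (apply (le_INR 1 n); lia).
assert (Hi : 0 < / theta < 1).
{ split; [apply Rinv_0_lt_compat; lra | rewrite <- Rinv_1; apply Rinv_lt_contravar; lra]. }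
set (alpha := ln 2 * (1 - / theta)) in *.
assert (Ha : 0 < alpha) by (apply Rmult_lt_0_compat; lra).
set (x := exp (- t)); set (z := exp (- (/ theta * t))).
assert (Hx : / 2 <= x <= 1).
{ unfold x; split; [rewrite <- exp_opp_ln2; apply exp_le; lra | apply exp_neg_bounds; lra]. }
assert (Hz : 0 < z <= 1) by (apply exp_neg_bounds; nra).
assert (Hxz : x <= z) by (apply exp_le; nra).
assert (Hzn : 0 <= z ^ n <= 1)
  by (apply pow_unit_interval; lra).
assert (Hxn : x ^ n <= z ^ n) by (apply pow_incr; lra).
(* Bernoulli gives [1 - x ^ n <= n * (1 - x)], the bound for the factor that is kept. *)
assert (Hb := pow_one_minus_ge n (1 - x) ltac:(lra)).
replace (1 - (1 - x)) with x in Hb by ring.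
unfold bump; replace (1 - (1 - (1 - z ^ n) ^ 2 ^ n)) with ((1 - z ^ n) ^ 2 ^ n) by ring.
assert (Hpow : (2 <= 2 ^ n)%nat) by (apply (Nat.pow_le_mono_r 2 1 n); lia).
replace (2 ^ n)%nat with (S (2 ^ n - 1)) at 1 by lia.
rewrite <- tech_pow_Rmult.
assert (Hm : exp (INR n * ln 2) / 2 <= INR (2 ^ n - 1)).
{ rewrite <- INR_pow2, minus_INR by lia.
  generalize (le_INR 2 (2 ^ n) Hpow); simpl (INR 1); simpl (INR 2); lra. }
assert (Hzl : exp (- (INR n * (/ theta * ln 2))) <= z ^ n).
{ unfold z; rewrite exp_pow; apply exp_le.
  assert (0 <= INR n * / theta * (ln 2 - t))
    by (apply Rmult_le_pos; [apply Rmult_le_pos |]; lra).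
  lra. }
(* The power is at most [exp (- v)] with [v >= exp (alpha * n) / 2 >= alpha ^ 2 * n ^ 2 / 8], hence
   at most [8 / (alpha ^ 2 * n ^ 2)]. This is below [eps / (2 * n)] once
   [n >= 16 / (alpha ^ 2 * eps)], which is the hypothesis on [n]. *)
assert (Hp : (1 - z ^ n) ^ (2 ^ n - 1) <= eps / (2 * INR n)).
{ apply Rle_trans with (1 := pow_one_minus_le_exp _ _ Hzn).
  assert (Hv : alpha ^ 2 * INR n ^ 2 / 8 <= INR (2 ^ n - 1) * z ^ n).
  { apply Rle_trans with (exp (INR n * ln 2) / 2 * exp (- (INR n * (/ theta * ln 2)))).
    - replace (exp (INR n * ln 2) / 2 * exp (- (INR n * (/ theta * ln 2))))
        with (exp (INR n * ln 2) * exp (- (INR n * (/ theta * ln 2))) / 2) by field.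
      rewrite <- exp_plus.
      replace (INR n * ln 2 + - (INR n * (/ theta * ln 2))) with (alpha * INR n)
        by (unfold alpha; ring).
      generalize (exp_sqr_le (alpha * INR n) ltac:(nra)); lra.
    - apply Rmult_le_compat; [| left; apply exp_pos | lra | lra].
      generalize (exp_pos (INR n * ln 2)); lra. }
  assert (0 < alpha ^ 2) by (apply pow_lt; lra).
  assert (Hv0 : 0 < alpha ^ 2 * INR n ^ 2 / 8).
  { assert (0 < alpha ^ 2 * INR n ^ 2) by (apply Rmult_lt_0_compat; [lra | apply pow_lt; lra]); lra. }
  apply Rle_trans with (1 := exp_opp_le_inv _ (Rlt_le_trans _ _ _ Hv0 Hv)).
  apply Rle_trans with (1 := Rinv_le_contravar _ _ Hv0 Hv).
  apply Rmult_le_reg_r with (alpha ^ 2 * INR n ^ 2 / 8 * (2 * INR n)); [apply Rmult_lt_0_compat; lra |].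
  replace (/ (alpha ^ 2 * INR n ^ 2 / 8) * (alpha ^ 2 * INR n ^ 2 / 8 * (2 * INR n)))
    with (2 * INR n) by (field; split; lra).
  replace (eps / (2 * INR n) * (alpha ^ 2 * INR n ^ 2 / 8 * (2 * INR n)))
    with (INR n * ((alpha ^ 2 * eps) * INR n / 8)) by (field; lra).
  assert (Hae : 0 < alpha ^ 2 * eps) by (apply Rmult_lt_0_compat; lra).
  apply (Rmult_le_compat_l _ _ _ (Rlt_le _ _ Hae)) in Hs.
  replace (alpha ^ 2 * eps * (16 / (alpha ^ 2 * eps))) with 16 in Hs by (field; lra).
  nra. }
apply Rle_trans with (INR n * (1 - x) * (eps / (2 * INR n))).
- apply Rmult_le_compat; [lra | apply pow_le; lra | lra | exact Hp].
- replace (INR n * (1 - x) * (eps / (2 * INR n))) with (eps * (/ 2 * (1 - x))) by (field; lra).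
  apply Rmult_le_compat_l; [lra |]; apply Rmult_le_compat_r; lra.
Qed.

Lemma exists_nat_above (a : R) : exists n : nat, (1 <= n)%nat /\ a <= INR n.
Proof.
destruct (INR_unbounded a) as [n Hn]; exists (S n); rewrite S_INR; split; [lia | lra].
Qed.

(** Stretching [t] by [theta] or by [/ theta] moves the smooth transition entirely to one side of
    the jump at [ln 2], so that one polynomial yields both a lower and an upper approximation. *)
Lemma bump_sandwich (theta eps : R) : 1 < theta -> 0 < eps ->
  exists n, (1 <= n)%nat /\ forall t, 0 <= t ->
  (ln 2 <= t -> bump n (exp (- (theta * t))) <= eps * (exp (- t) * (1 - exp (- t)))) /\
  (t <= ln 2 -> 1 - bump n (exp (- (/ theta * t))) <= eps * (exp (- t) * (1 - exp (- t)))).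
Proof.
intros Hth He; assert (H2 := ln2_pos).
destruct (exists_nat_above (Rmax ((1 - ln (eps / 2) / ln 2) / (theta - 1))
  (16 / ((ln 2 * (1 - / theta)) ^ 2 * eps)))) as [n [Hn1 Hn]].
exists n; split; [exact Hn1 |]; intros t Ht; split; intros Htl.
- apply bump_small; try assumption.
  rewrite <- (exp_ln (eps / 2)) by lra; apply exp_le.
  assert (Ha := Rle_trans _ _ _ (Rmax_l _ _) Hn).
  apply (Rmult_le_compat_r (theta - 1)) in Ha; [| lra].
  replace ((1 - ln (eps / 2) / ln 2) / (theta - 1) * (theta - 1))
    with (1 - ln (eps / 2) / ln 2) in Ha by (field; lra).
  apply (Rmult_le_compat_r (ln 2)) in Ha; [| lra].
  replace ((1 - ln (eps / 2) / ln 2) * ln 2) with (ln 2 - ln (eps / 2)) in Ha by (field; lra).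
  lra.
- apply bump_large; try assumption; [| lra].
  exact (Rle_trans _ _ _ (Rmax_r _ _) Hn).
Qed.

(* With [d = ln 2 / lam N], the indicator of [m <= N] lies between
   [bump n (exp (- theta d lam_m))] and [bump n (exp (- d lam_m / theta))] up to
   [eps x (1 - x)], [x = exp (- d lam_m)], and the [x (1 - x)] sums converge. *)
Lemma tauber_approx (eta : R) : 0 < eta ->
  exists kappa, forall w lam c, log_laplace w lam c ->
  exists N0, forall N, (N0 <= N)%nat ->
    Rabs (sum_f_R0 w N - ln (lam N) - c - kappa) <= eta.
Proof.
intros Heta.
set (q := fun x : R => x ^ 1 * (1 - x ^ 1) ^ 1).
destruct (regularizable_pow_mul 1 1 1 (le_n 1) : regularizable q) as [K HK].
(* [K] is the limit of the sums of [q], so this choice keeps their contribution near [eta / 3] at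
   most; the [+ 1] guards against [K = 0]. *)
set (eps := eta / (3 * (Rabs K + 1))).
assert (HKp := Rabs_pos K).
assert (Heps : 0 < eps) by (apply Rdiv_lt_0_compat; lra).
assert (HepsK : eps * Rabs K <= eta / 3).
{ apply Rle_trans with (eps * (Rabs K + 1)); [apply Rmult_le_compat_l; lra |].
  right; unfold eps; field; lra. }
(* Rescaling [d] by [theta] shifts [ln d] by [ln theta], that is by [eta / 3]. *)
set (theta := exp (eta / 3)).
assert (Hth : 1 < theta) by (rewrite <- exp_0; apply exp_increasing; lra).
assert (Hth0 : 0 < / theta) by (apply Rinv_0_lt_compat; lra).
assert (H2 := ln2_pos).
destruct (bump_sandwich theta eps Hth Heps) as [n [Hn Hf]].
destruct (regularizable_bump n (2 ^ n) Hn : regularizable (bump n)) as [kf Hkf].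
(* [ln (ln 2)] comes from [ln d = ln (ln 2) - ln (lam N)]. This constant varies with [eta], through
   [n], but not with the measure. *)
exists (kf - ln (ln 2)); intros w lam c Hs.
destruct (HK w lam c Hs) as [Xq Lq]; destruct (Hkf w lam c Hs) as [Xf Lf]; clear HK Hkf.
assert (Hpos := ll_pos _ _ _ Hs).
set (d := fun N => ln 2 / lam N).
assert (Hd : forall N, 0 < d N) by (intros N; apply Rdiv_lt_0_compat; auto).
assert (Hd0 : is_lim_seq d 0).
{ replace (Finite 0) with (Rbar_mult (ln 2) (Rbar_inv p_infty))
    by (simpl; rewrite Rmult_0_r; reflexivity).
  apply is_lim_seq_scal_l, is_lim_seq_inv; [apply (ll_infty _ _ _ Hs) | discriminate]. }
assert (Hlnd : forall N, ln (d N) = ln (ln 2) - ln (lam N)).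
{ intros N; unfold d, Rdiv.
  rewrite ln_mult, ln_Rinv by auto using Rinv_0_lt_compat; ring. }
assert (Hdl : forall N, d N * lam N = ln 2)
  by (intros N; unfold d; field; apply Rgt_not_eq, Hpos).
assert (Hdn : forall N m, 0 <= d N * lam m)
  by (intros; apply Rmult_le_pos; left; auto).
assert (Hlt : forall N m, (m <= N)%nat -> d N * lam m <= ln 2).
{ intros N m Hm; rewrite <- (Hdl N); apply Rmult_le_compat_l; [left; auto |].
  apply (ll_incr _ _ _ Hs), Hm. }
assert (Hgt : forall N m, (N <= m)%nat -> ln 2 <= d N * lam m).
{ intros N m Hm; rewrite <- (Hdl N); apply Rmult_le_compat_l; [left; auto |].
  apply (ll_incr _ _ _ Hs), Hm. }
(* The partial sum is rewritten as a series, so that it can be compared with the Laplace sums term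
   by term. *)
set (chi := fun N m => if le_dec m N then w m else 0).
assert (Hchi : forall N, is_series (chi N) (sum_f_R0 w N)).
{ intros N; apply is_series_Reals; intros e He; exists N; intros m Hm.
  replace (sum_f_R0 (chi N) m) with (sum_f_R0 w N); [rewrite R_dist_eq; exact He |].
  induction Hm as [|m Hm IH].
  - apply sum_eq; intros i Hi; unfold chi; destruct (le_dec i N); [reflexivity | contradiction].
  - simpl; rewrite <- IH; unfold chi; destruct (le_dec (S m) N); [lia | ring]. }
assert (Hq0 : forall t, 0 <= t -> 0 <= q (exp (- t))).
{ intros t Ht; generalize (exp_neg_bounds t Ht); unfold q; simpl; nra. }
assert (Hqe : forall t, q (exp (- t)) = exp (- t) * (1 - exp (- t)))
  by (intros; unfold q; ring).
assert (Hqn : q 1 = 0) by (unfold q; ring).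
assert (Hbb : forall s N m, 0 < s -> 0 <= bump n (exp (- (s * d N * lam m))) <= 1).
{ intros s N m H0; apply bump_bounds; rewrite Rmult_assoc.
  generalize (exp_neg_bounds (s * (d N * lam m)) ltac:(apply Rmult_le_pos; [lra | auto])); lra. }
assert (Hlow : forall N, laplace w lam (bump n) (theta * d N) <=
  sum_f_R0 w N + eps * laplace w lam q (d N)).
{ intros N; rewrite <- (is_series_unique _ _ (Hchi N)); unfold laplace.
  assert (Xe := ex_series_scal eps _ (Xq (d N) (Hd N)) :
    ex_series (fun m => eps * (w m * q (exp (- (d N * lam m)))))).
  rewrite <- Series_scal_l, <- Series_plus; [| eexists; apply Hchi | exact Xe].
  apply Series_le; [| apply (ex_series_plus (chi N)); [eexists; apply Hchi | exact Xe]].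
  intros m; assert (Hw := ll_w _ _ _ Hs m).
  assert (Hb := Hbb theta N m ltac:(lra)).
  split; [apply Rmult_le_pos; [exact Hw | apply Hb] |].
  assert (0 <= eps * (w m * q (exp (- (d N * lam m)))))
    by (apply Rmult_le_pos; [lra | apply Rmult_le_pos; auto]).
  unfold chi; destruct (le_dec m N) as [Hm|Hm].
  - assert (w m * bump n (exp (- (theta * d N * lam m))) <= w m * 1)
      by (apply Rmult_le_compat_l; [exact Hw | apply Hb]).
    lra.
  - destruct (Hf _ (Hdn N m)) as [F _]; specialize (F (Hgt N m ltac:(lia))).
    rewrite <- Hqe, <- Rmult_assoc in F.
    apply (Rmult_le_compat_l (w m)) in F; [lra | exact Hw]. }
assert (Hupp : forall N, sum_f_R0 w N <=
  laplace w lam (bump n) (/ theta * d N) + eps * laplace w lam q (d N)).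
{ intros N; rewrite <- (is_series_unique _ _ (Hchi N)); unfold laplace.
  assert (Xe := ex_series_scal eps _ (Xq (d N) (Hd N)) :
    ex_series (fun m => eps * (w m * q (exp (- (d N * lam m)))))).
  assert (Xb := Xf (/ theta * d N) (Rmult_lt_0_compat _ _ Hth0 (Hd N))).
  rewrite <- Series_scal_l, <- Series_plus; [| exact Xb | exact Xe].
  apply Series_le; [| exact (ex_series_plus _ _ Xb Xe)].
  intros m; assert (Hw := ll_w _ _ _ Hs m).
  assert (Hb := Hbb (/ theta) N m Hth0).
  assert (0 <= eps * (w m * q (exp (- (d N * lam m)))))
    by (apply Rmult_le_pos; [lra | apply Rmult_le_pos; auto]).
  assert (0 <= w m * bump n (exp (- (/ theta * d N * lam m))))
    by (apply Rmult_le_pos; [exact Hw | apply Hb]).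
  unfold chi; destruct (le_dec m N) as [Hm|Hm]; [| lra].
  split; [exact Hw |].
  destruct (Hf _ (Hdn N m)) as [_ F]; specialize (F (Hlt N m Hm)).
  rewrite <- Hqe, <- Rmult_assoc in F.
  apply (Rmult_le_compat_l (w m)) in F; [lra | exact Hw]. }
(* As [q 1 = 0], no logarithm has to be subtracted and the sums of [q] converge as they stand. *)
assert (Lq' : is_lim_seq (fun N => eps * laplace w lam q (d N)) (eps * K)).
{ apply (is_lim_seq_scal_l _ eps K).
  apply is_lim_seq_ext with (2 := Lq d Hd Hd0); intros N; rewrite Hqn; ring. }
assert (Hln : ln theta = eta / 3) by apply ln_exp.
assert (Llow : is_lim_seq (fun N => laplace w lam (bump n) (theta * d N)
  + (eta / 3 + (ln (ln 2) - ln (lam N)) - c)) kf).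
{ apply is_lim_seq_ext with (2 := at_zero_scal _ _ theta ltac:(lra) Lf d Hd Hd0).
  intros N; rewrite bump_1, ln_mult, Hlnd, Hln by (auto; lra); ring. }
assert (Lupp : is_lim_seq (fun N => laplace w lam (bump n) (/ theta * d N)
  + (- (eta / 3) + (ln (ln 2) - ln (lam N)) - c)) kf).
{ apply is_lim_seq_ext with (2 := at_zero_scal _ _ (/ theta) Hth0 Lf d Hd Hd0).
  intros N; rewrite bump_1, ln_mult, Hlnd, ln_Rinv, Hln by (auto; lra); ring. }
clear Lf Lq.
(* Error budget: [eta / 3] from [theta], [eta / 3 + eta / 9] from [q] and [eta / 9] from the
   bump. *)
assert (He9 : 0 < eta / 9) by lra.
destruct (proj1 (is_lim_seq_eps _ _) Lq' _ He9) as [N1 H1].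
destruct (proj1 (is_lim_seq_eps _ _) Llow _ He9) as [N2 H3].
destruct (proj1 (is_lim_seq_eps _ _) Lupp _ He9) as [N3 H4].
exists (N1 + N2 + N3)%nat; intros N HN.
specialize (H1 N ltac:(lia)); specialize (H3 N ltac:(lia)); specialize (H4 N ltac:(lia)).
specialize (Hlow N); specialize (Hupp N).
assert (HeK : - (eta / 3) <= eps * K <= eta / 3).
{ assert (Rabs (eps * K) <= eta / 3) by (rewrite Rabs_mult, (Rabs_pos_eq eps) by lra; exact HepsK).
  apply Rabs_le_between; assumption. }
apply Rabs_lt_between in H1; apply Rabs_lt_between in H3; apply Rabs_lt_between in H4.
apply Rabs_le_between; lra.
Qed.

(* The unknown constants of [tauber_approx] cancel when two systems are compared. *)
Lemma tauber_transfer (w lam w' lam' : nat -> R) (c c' l : R) :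
  log_laplace w lam c -> log_laplace w' lam' c' ->
  is_lim_seq (fun N => sum_f_R0 w' N - ln (lam' N) - c') l ->
  is_lim_seq (fun N => sum_f_R0 w N - ln (lam N) - c) l.
Proof.
intros H H' Hl; apply is_lim_seq_eps; intros eps He.
destruct (tauber_approx (eps / 4) ltac:(lra)) as [k Hk].
destruct (Hk _ _ _ H) as [N1 H1]; destruct (Hk _ _ _ H') as [N2 H2].
destruct (proj1 (is_lim_seq_eps _ _) Hl (eps / 4) ltac:(lra)) as [N3 H3].
exists (N1 + N2 + N3)%nat; intros N HN.
(* The two systems are read at unrelated indices: any large index of the second one locates [k]
   within [eps / 2] of [l], and [k] then controls the first one. *)
specialize (H1 N ltac:(lia)); specialize (H2 (N + N2 + N3)%nat ltac:(lia));
  specialize (H3 (N + N2 + N3)%nat ltac:(lia)).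
apply Rabs_le_between in H1; apply Rabs_le_between in H2; apply Rabs_lt_between in H3.
apply Rabs_lt_between; lra.
Qed.

(** * Sieving and Euler products *)

(** All [d] from 2 to [k] are tested as divisors, not only primes, so the definition needs no
    primality test; [rough_S_composite] shows that composite [d] remove nothing new. *)
Fixpoint rough (k n : nat) : bool :=
  match k with
  | O => true
  | S k' => rough k' n && ((k <=? 1)%nat || negb (n mod k =? 0)%nat)
  end.

Definition primeb (p : nat) : bool := if prime_dec (Z.of_nat p) then true else false.

Lemma rough_S (k n : nat) :
  rough (S k) n = rough k n && ((S k <=? 1)%nat || negb (n mod S k =? 0)%nat).
Proof. reflexivity. Qed.

Lemma rough_spec (k n : nat) :
  rough k n = true <-> forall d, (2 <= d <= k)%nat -> ~ Nat.divide d n.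
Proof.
induction k as [|k IH].
- split; [intros _ d Hd; lia | reflexivity].
- rewrite rough_S, andb_true_iff, IH, orb_true_iff, negb_true_iff, Nat.eqb_neq, Nat.leb_le.
  split.
  + intros [H1 H2] d Hd.
    destruct (Nat.eq_dec d (S k)) as [->|Hne]; [| apply H1; lia].
    destruct H2 as [H2|H2]; [lia |].
    intros Hdiv; apply H2, Nat.Lcm0.mod_divide; exact Hdiv.
  + intros H; split; [intros d Hd; apply H; lia |].
    destruct (Nat.le_gt_cases (S k) 1) as [H1|H1]; [left; exact H1 | right].
    intros H2; apply (H (S k)); [lia | apply Nat.Lcm0.mod_divide; exact H2].
Qed.

Lemma rough_ext (k m n : nat) :
  (forall d, (2 <= d <= k)%nat -> Nat.divide d m <-> Nat.divide d n) ->
  rough k m = rough k n.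
Proof.
intros H; apply eq_true_iff_eq; rewrite !rough_spec.
split; intros H1 d Hd Hdiv; apply (H1 d Hd), H; assumption.
Qed.

Lemma primeb_spec (p : nat) : primeb p = true <-> prime (Z.of_nat p).
Proof. unfold primeb; destruct (prime_dec (Z.of_nat p)); split; congruence || auto. Qed.

Lemma primeb_lt_2 (p : nat) : (p < 2)%nat -> primeb p = false.
Proof.
intros H; apply not_true_iff_false; rewrite primeb_spec; intros Hp.
apply prime_ge_2 in Hp; lia.
Qed.

Lemma divide_Z_of_nat (a b : nat) : (Z.of_nat a | Z.of_nat b)%Z <-> Nat.divide a b.
Proof.
split.
- intros [q Hq]; destruct (Nat.eq_dec a 0) as [->|Ha].
  + exists 0%nat; lia.
  + exists (Z.to_nat q); nia.
- intros [q ->]; exists (Z.of_nat q); lia.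
Qed.

(** A proper divisor of [S k] was tested earlier, and it divides every multiple of [S k]. *)
Lemma rough_S_composite (k n : nat) : primeb (S k) = false -> rough (S k) n = rough k n.
Proof.
intros Hp; apply eq_true_iff_eq; rewrite !rough_spec.
split; intros H d Hd; [apply H; lia |].
destruct (Nat.eq_dec d (S k)) as [->|Hne]; [| apply H; lia].
destruct (not_prime_divide (Z.of_nat (S k))) as [e [He1 He2]]; [lia | |].
- intros Hc; apply primeb_spec in Hc; congruence.
- intros Hdiv; apply (H (Z.to_nat e)); [lia |].
  apply Nat.divide_trans with (2 := Hdiv), divide_Z_of_nat.
  rewrite Z2Nat.id by lia; exact He2.
Qed.

Lemma rough_S_prime (k n : nat) : primeb (S k) = true ->
  rough (S k) n = rough k n && negb (n mod S k =? 0)%nat.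
Proof.
intros Hp; apply primeb_spec, prime_ge_2 in Hp.
rewrite rough_S; replace (S k <=? 1)%nat with false; [reflexivity |].
symmetry; apply Nat.leb_gt; lia.
Qed.

(** Each [d] with [2 <= d <= k] is coprime to the larger prime [S k], so Gauss's lemma cancels that
    prime. *)
Lemma rough_prime_mul (k m : nat) : primeb (S k) = true -> rough k (S k * m) = rough k m.
Proof.
intros Hp; apply primeb_spec in Hp; apply rough_ext; intros d Hd; split.
- intros Hdiv; apply divide_Z_of_nat; apply divide_Z_of_nat in Hdiv.
  rewrite Nat2Z.inj_mul in Hdiv; apply Gauss with (1 := Hdiv).
  apply rel_prime_le_prime; [exact Hp | lia].
- intros Hdiv; apply Nat.divide_mul_r, Hdiv.
Qed.

Lemma rough_one (k : nat) : rough k 1 = true.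
Proof. apply rough_spec; intros d Hd Hdiv; apply Nat.divide_1_r in Hdiv; lia. Qed.

Lemma rough_self (k n : nat) : (2 <= n <= k)%nat -> rough k n = false.
Proof.
intros H; apply not_true_iff_false; rewrite rough_spec; intros Hr.
exact (Hr n H (Nat.divide_refl n)).
Qed.

(** The masked series is constant between multiples of [p], so the partial sums over multiples form
    a subsequence of its partial sums. *)
Lemma is_series_multiples (a : nat -> R) (p : nat) (s : R) : (1 <= p)%nat ->
  is_series (fun n => if (n mod p =? 0)%nat then a n else 0) s ->
  is_series (fun m => a (p * m)%nat) s.
Proof.
intros Hp Hs; set (e := fun n => if (n mod p =? 0)%nat then a n else 0) in Hs.
assert (Hej : forall M j, (j < p)%nat -> sum_f_R0 e (p * M + j) = sum_f_R0 e (p * M)).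
{ intros M; induction j as [|j IH]; intros Hj; [rewrite Nat.add_0_r; reflexivity |].
  rewrite Nat.add_succ_r; simpl; rewrite IH by lia.
  unfold e at 2; replace (S (p * M + j) mod p =? 0)%nat with false; [ring |].
  symmetry; apply Nat.eqb_neq.
  rewrite <- (Nat.mod_unique (S (p * M + j)) p M (S j)); lia. }
assert (He : forall M, e (p * M)%nat = a (p * M)%nat).
{ intros M; unfold e; replace (p * M)%nat with (0 + M * p)%nat by ring.
  rewrite Nat.Div0.mod_add, Nat.Div0.mod_0_l; reflexivity. }
assert (HM : forall M, sum_f_R0 e (p * M) = sum_f_R0 (fun m => a (p * m)%nat) M).
{ induction M as [|M IH].
  - simpl sum_f_R0 at 2; rewrite <- He, Nat.mul_0_r; reflexivity.
  - simpl sum_f_R0; rewrite <- IH, <- (Hej M (p - 1)%nat), <- He by lia.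
    replace (p * S M)%nat with (S (p * M + (p - 1))) by lia; reflexivity. }
change (is_lim_seq (sum_n (fun m => a (p * m)%nat)) s).
apply (is_lim_seq_ext (fun M => sum_n e (p * M))).
- intros M; rewrite !sum_n_Reals; apply HM.
- apply (is_lim_seq_subseq (sum_n e) s (fun M => (p * M)%nat)); [| exact Hs].
  apply eventually_subseq; intros n; nia.
Qed.

Lemma ex_series_restrict (a : nat -> R) (P : nat -> bool) :
  ex_series (fun n => Rabs (a n)) -> ex_series (fun n => if P n then a n else 0).
Proof.
apply ex_series_dominated; intros n; destruct (P n); [lra |].
rewrite Rabs_R0; apply Rabs_pos.
Qed.

Record summable_multiplicative (g : nat -> R) : Prop := {
  cm_0 : g 0%nat = 0;
  cm_1 : g 1%nat = 1;
  cm_mul : forall a b, g (a * b)%nat = g a * g b;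
  cm_abs : ex_series (fun n => Rabs (g n)) }.

(* Passing from [k] to a prime [S k] removes the multiples of [S k], whose sum is [g (S k)]
   times the previous sum. *)
Lemma sieve (g : nat -> R) (k : nat) : summable_multiplicative g ->
  prod_upto (fun p => if primeb p then 1 - g p else 1) k * Series g =
  Series (fun n => if rough k n then g n else 0).
Proof.
intros [_ _ g_mul g_abs]; induction k as [|k IH];
  [unfold prod_upto, rough; rewrite primeb_lt_2 by lia; apply Rmult_1_l |].
simpl prod_upto; rewrite Rmult_assoc, (Rmult_comm _ (Series g)), <- Rmult_assoc, IH.
destruct (primeb (S k)) eqn:Hp.
- set (r := fun n => if rough k n then g n else 0).
  assert (Hr : ex_series (fun n => Rabs (r n))).
  { apply ex_series_dominated with (2 := g_abs); intros n; rewrite Rabs_Rabsolu.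
    unfold r; destruct (rough k n); [lra | rewrite Rabs_R0; apply Rabs_pos]. }
  assert (Hm : ex_series (fun n => if (n mod S k =? 0)%nat then r n else 0))
    by (apply ex_series_restrict, Hr).
  assert (Hs : Series (fun m => r (S k * m)%nat) =
    Series (fun n => if (n mod S k =? 0)%nat then r n else 0))
    by (apply is_series_unique, is_series_multiples, Series_correct, Hm; lia).
  transitivity (Series r - Series (fun n => if (n mod S k =? 0)%nat then r n else 0)).
  + rewrite <- Hs.
    rewrite (Series_ext (fun m => r (S k * m)%nat) (fun m => g (S k) * r m)).
    * rewrite Series_scal_l; ring.
    * intros m; unfold r; rewrite rough_prime_mul, g_mul by exact Hp.
      destruct (rough k m); ring.
  + rewrite <- Series_minus by (apply ex_series_Rabs, Hr || exact Hm).
    apply Series_ext; intros n; rewrite rough_S_prime by exact Hp; unfold r.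
    destruct (rough k n), (n mod S k =? 0)%nat; simpl; ring.
- rewrite Rmult_1_r; apply Series_ext; intros n.
  rewrite rough_S_composite by exact Hp; reflexivity.
Qed.

(** A fixed [n >= 2] is sieved out once [k >= n], so only the term [g 1 = 1] survives, with
    [Rabs (g n)] as majorant. Keeping the series as a factor, instead of dividing by it, lets
    [euler_product_ln] deduce that it is positive. *)
Lemma euler_product (g : nat -> R) : summable_multiplicative g ->
  is_lim_seq (fun k => prod_upto (fun p => if primeb p then 1 - g p else 1) k * Series g) 1.
Proof.
intros Hg; apply is_lim_seq_ext with (1 := fun k => eq_sym (sieve g k Hg)).
destruct Hg as [g_0 g_1 _ g_abs].
set (l := fun n => if (n =? 1)%nat then 1 else 0).
replace 1 with (Series l).
- apply tannery with (2 := g_abs).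
  + intros k n; destruct (rough k n); [lra | rewrite Rabs_R0; apply Rabs_pos].
  + intros n; unfold l.
    apply is_lim_seq_ext_loc with (u := fun _ => if (n =? 1)%nat then 1 else 0);
      [| apply is_lim_seq_const].
    exists n; intros k Hk.
    destruct n as [|[|n]].
    * simpl; rewrite g_0; destruct (rough k 0); reflexivity.
    * rewrite rough_one, g_1; reflexivity.
    * rewrite rough_self by lia; reflexivity.
- apply is_series_unique, is_series_Reals; intros e He; exists 1%nat; intros n Hn.
  replace (sum_f_R0 l n) with 1; [rewrite R_dist_eq; exact He |].
  induction Hn as [|n Hn IH]; [unfold l; simpl; ring |].
  simpl; rewrite <- IH; unfold l.
  replace (S n =? 1)%nat with false by (symmetry; apply Nat.eqb_neq; lia); ring.
Qed.

(** * The quadratic character modulo 4 *)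

(* [n ^ - (1 + d)]; the junk value [npow d 0 = 1] is always multiplied by [chi4 0 = 0]. *)
Definition npow (d : R) (n : nat) : R := exp (- ((1 + d) * ln (INR n))).

Definition chi4 (n : nat) : R :=
  match (n mod 4)%nat with 1%nat => 1 | 3%nat => -1 | _ => 0 end.

Lemma chi4_mul (a b : nat) : chi4 (a * b) = chi4 a * chi4 b.
Proof.
unfold chi4; rewrite Nat.Div0.mul_mod.
assert (Ha := Nat.mod_upper_bound a 4 ltac:(lia)).
assert (Hb := Nat.mod_upper_bound b 4 ltac:(lia)).
destruct (a mod 4)%nat as [|[|[|[|x]]]]; [| | | | lia];
destruct (b mod 4)%nat as [|[|[|[|y]]]]; (lia || simpl; ring).
Qed.

Lemma chi4_cases (n : nat) : chi4 n = 0 \/ chi4 n = 1 \/ chi4 n = -1.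
Proof. unfold chi4; destruct (n mod 4)%nat as [|[|[|[|x]]]]; auto. Qed.

Lemma chi4_0 : chi4 0 = 0. Proof. reflexivity. Qed.

Lemma chi4_even (k : nat) : chi4 (2 * k) = 0.
Proof.
rewrite chi4_mul; unfold chi4 at 1; simpl; ring.
Qed.

Lemma chi4_odd (k : nat) : chi4 (2 * k + 1) = (-1) ^ k.
Proof.
assert (H : forall a, chi4 (4 + a) = chi4 a).
{ intros a; unfold chi4; replace (4 + a)%nat with (a + 1 * 4)%nat by ring.
  rewrite Nat.Div0.mod_add; reflexivity. }
(* Period 4 in the argument is period 2 in [k], so the induction carries two consecutive values. *)
enough (E : chi4 (2 * k + 1) = (-1) ^ k /\ chi4 (2 * S k + 1) = (-1) ^ S k) by apply E.
induction k as [|k [I1 I2]]; [split; unfold chi4; simpl; ring |].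
split; [exact I2 |].
replace (2 * S (S k) + 1)%nat with (4 + (2 * k + 1))%nat by ring.
rewrite H, I1; simpl; ring.
Qed.

Lemma npow_pos (d : R) (n : nat) : 0 < npow d n.
Proof. apply exp_pos. Qed.

Lemma npow_mul (d : R) (a b : nat) : (1 <= a)%nat -> (1 <= b)%nat ->
  npow d (a * b) = npow d a * npow d b.
Proof.
intros Ha Hb; unfold npow; rewrite mult_INR, ln_mult, <- exp_plus by (apply lt_0_INR; lia).
f_equal; ring.
Qed.

Lemma npow_1 (d : R) : npow d 1 = 1.
Proof. unfold npow; simpl; rewrite ln_1, Rmult_0_r, Ropp_0, exp_0; reflexivity. Qed.

Lemma ln_INR_le (m n : nat) : (1 <= m <= n)%nat -> ln (INR m) <= ln (INR n).
Proof. intros H; apply ln_le; [apply lt_0_INR; lia | apply le_INR; lia]. Qed.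

Lemma ln_INR_pos (n : nat) : (2 <= n)%nat -> 0 < ln (INR n).
Proof.
intros H; rewrite <- ln_1; apply ln_increasing; [lra |].
apply (lt_INR 1); lia.
Qed.

Lemma npow_decr (d : R) (m n : nat) : 0 <= d -> (1 <= m <= n)%nat -> npow d n <= npow d m.
Proof.
intros Hd H; apply exp_le; generalize (ln_INR_le m n H); intros.
apply Ropp_le_contravar, Rmult_le_compat_l; lra.
Qed.

Lemma npow_le_half (d : R) (n : nat) : 0 <= d -> (2 <= n)%nat -> npow d n <= / 2.
Proof.
intros Hd H; apply Rle_trans with (1 := npow_decr d 2 n Hd ltac:(lia)).
rewrite <- exp_opp_ln2; apply exp_le.
replace (INR 2) with 2 by (simpl; ring).
generalize ln2_pos; nra.
Qed.

Lemma is_lim_seq_ln_INR (k : nat) : is_lim_seq (fun n => ln (INR (n + k))) p_infty.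
Proof.
apply (is_lim_seq_incr_n (fun n => ln (INR n)) k).
apply (is_lim_comp_seq ln INR p_infty p_infty); [apply is_lim_ln_p | | apply is_lim_seq_INR].
exists 0%nat; intros; discriminate.
Qed.

Lemma is_lim_seq_exp_m_infty (u : nat -> R) (d : R) :
  0 < d -> is_lim_seq u p_infty -> is_lim_seq (fun n => exp (- (d * u n))) 0.
Proof.
intros Hd Hu; apply (is_lim_comp_seq exp (fun n => - (d * u n)) m_infty 0).
- apply is_lim_exp_m.
- exists 0%nat; intros; discriminate.
- apply (is_lim_seq_opp _ p_infty).
  replace p_infty with (Rbar_mult d p_infty).
  + apply is_lim_seq_scal_l, Hu.
  + unfold Rbar_mult, Rbar_mult'; destruct Rle_dec as [H|H]; [| lra].
    destruct Rle_lt_or_eq_dec; [reflexivity | lra].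
Qed.

Lemma sum_odd (a : nat -> R) : (forall k, a (2 * k)%nat = 0) ->
  forall N, sum_f_R0 a (2 * N + 1) = sum_f_R0 (fun k => a (2 * k + 1)%nat) N.
Proof.
intros H; induction N as [|N IH].
- simpl; generalize (H 0%nat); simpl; intros ->; ring.
- replace (2 * S N + 1)%nat with (S (S (2 * N + 1))) by ring.
  rewrite !tech5, IH.
  replace (S (2 * N + 1)) with (2 * S N)%nat by ring; rewrite H.
  replace (S (2 * S N)) with (2 * S N + 1)%nat by ring; ring.
Qed.

Lemma is_lim_seq_sum_odd (a : nat -> R) : (forall k, a (2 * k)%nat = 0) -> ex_series a ->
  is_lim_seq (fun N => sum_f_R0 (fun k => a (2 * k + 1)%nat) N) (Series a).
Proof.
intros H Ha; apply is_lim_seq_ext with (fun N => sum_n a (2 * N + 1)).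
- intros N; rewrite sum_n_Reals; apply sum_odd, H.
- apply (is_lim_seq_subseq (sum_n a) _ (fun N => (2 * N + 1)%nat)).
  + apply eventually_subseq; intros; lia.
  + exact (Series_correct a Ha).
Qed.

(* Mean value theorem for [x ^ (- d)] on [[n, n + 2]]. *)
Lemma npow_telescope (d : R) (n : nat) : 0 < d -> (1 <= n)%nat ->
  2 * d * npow d (n + 2) <= exp (- (d * ln (INR n))) - exp (- (d * ln (INR (n + 2))))
  <= 2 * d * npow d n.
Proof.
intros Hd Hn.
assert (Hn0 : 1 <= INR n) by (apply (le_INR 1); lia).
assert (Hn2 : INR (n + 2) = INR n + 2) by (rewrite plus_INR; simpl; ring).
destruct (MVT_cor2 (fun x => exp (- (d * ln x))) (fun x => - d * exp (- ((1 + d) * ln x)))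
  (INR n) (INR (n + 2))) as [c [Hc1 Hc2]]; [lra | |].
- intros c Hc; apply is_derive_Reals; auto_derive; [lra |].
  replace (- ((1 + d) * ln c)) with (- ln c + - (d * ln c)) by ring.
  rewrite exp_plus, (exp_Ropp (ln c)), exp_ln by lra; field; lra.
- assert (H1 : npow d (n + 2) <= exp (- ((1 + d) * ln c))).
  { apply exp_le, Ropp_le_contravar, Rmult_le_compat_l; [lra |].
    apply ln_le; lra. }
  assert (H2 : exp (- ((1 + d) * ln c)) <= npow d n).
  { apply exp_le, Ropp_le_contravar, Rmult_le_compat_l; [lra |].
    apply ln_le; lra. }
  rewrite Hn2 in Hc1 at 2.
  split; nra.
Qed.

Lemma npow_odd_sum_bounds (d : R) (N : nat) : 0 < d ->
  2 * d * sum_f_R0 (fun k => npow d (2 * k + 1)) N - 2 * d <= 1 /\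
  1 - exp (- (d * ln (INR (2 * N + 3)))) <= 2 * d * sum_f_R0 (fun k => npow d (2 * k + 1)) N.
Proof.
intros Hd; set (s := sum_f_R0 (fun k => npow d (2 * k + 1))).
(* The induction sums [npow_telescope] over odd [n]. In the upper bound the term [k = 0], equal to
   1, has no left neighbour and accounts for the [2 * d]. *)
assert (H : 2 * d * s N - 2 * d <= 1 - exp (- (d * ln (INR (2 * N + 1)))) /\
  1 - exp (- (d * ln (INR (2 * N + 3)))) <= 2 * d * s N).
{ unfold s; induction N as [|N [IH1 IH2]].
  - generalize (npow_telescope d 1 Hd ltac:(lia)); simpl sum_f_R0; simpl (2 * 0 + 1)%nat.
    simpl (2 * 0 + 3)%nat; simpl (1 + 2)%nat; simpl (INR 1).
    rewrite npow_1, ln_1, Rmult_0_r, Ropp_0, exp_0; lra.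
  - generalize (npow_telescope d (2 * N + 1) Hd ltac:(lia))
      (npow_telescope d (2 * S N + 1) Hd ltac:(lia)); rewrite !tech5.
    replace (2 * N + 1 + 2)%nat with (2 * S N + 1)%nat by ring.
    replace (2 * S N + 1 + 2)%nat with (2 * S N + 3)%nat by ring.
    replace (2 * N + 3)%nat with (2 * S N + 1)%nat in IH2 by ring.
    lra. }
generalize (exp_pos (- (d * ln (INR (2 * N + 1))))); lra.
Qed.

(** The square of [chi4] is the principal character modulo 4, so this is [(1 - 2^-s) zeta(s)] at
    [s = 1 + d], in the shape [chi n * npow d n] that it shares with [L_chi4]. *)
Definition zeta_odd (d : R) : R := Series (fun n => chi4 n ^ 2 * npow d n).
Definition L_chi4 (d : R) : R := Series (fun n => chi4 n * npow d n).

Lemma chi4_sqr_npow_pos (d : R) (n : nat) : 0 <= chi4 n ^ 2 * npow d n.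
Proof. apply Rmult_le_pos; [apply pow2_ge_0 | left; apply npow_pos]. Qed.

Lemma chi4_sqr_even (d : R) (k : nat) : chi4 (2 * k) ^ 2 * npow d (2 * k) = 0.
Proof. rewrite chi4_even; ring. Qed.

Lemma chi4_sqr_odd_sum (d : R) (N : nat) :
  sum_f_R0 (fun k => chi4 (2 * k + 1) ^ 2 * npow d (2 * k + 1)) N =
  sum_f_R0 (fun k => npow d (2 * k + 1)) N.
Proof.
apply sum_eq; intros k _; rewrite chi4_odd, <- pow_mult, Nat.mul_comm, pow_1_even; ring.
Qed.

Lemma ex_zeta_odd (d : R) : 0 < d -> ex_series (fun n => chi4 n ^ 2 * npow d n).
Proof.
intros Hd; set (a := fun n => chi4 n ^ 2 * npow d n).
assert (Hmon : forall m n, (m <= n)%nat -> sum_f_R0 a m <= sum_f_R0 a n).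
{ intros m n Hmn; induction Hmn as [|n Hmn IH]; [lra |].
  simpl; generalize (chi4_sqr_npow_pos d (S n)); unfold a at 3; lra. }
destruct (ex_finite_lim_seq_incr (sum_n a) ((1 + 2 * d) / (2 * d))) as [l Hl].
- intros n; rewrite !sum_n_Reals; apply Hmon; lia.
- intros n; rewrite sum_n_Reals; apply Rle_trans with (1 := Hmon n (2 * n + 1)%nat ltac:(lia)).
  rewrite (sum_odd a (chi4_sqr_even d)); unfold a; rewrite chi4_sqr_odd_sum.
  apply Rmult_le_reg_l with (2 * d); [lra |].
  replace (2 * d * ((1 + 2 * d) / (2 * d))) with (1 + 2 * d) by (field; lra).
  generalize (proj1 (npow_odd_sum_bounds d n Hd)); lra.
- exists l; exact Hl.
Qed.

Lemma zeta_odd_residue : at_zero (fun d => d * zeta_odd d) (/ 2).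
Proof.
assert (H : forall d, 0 < d -> / 2 <= d * zeta_odd d <= / 2 + d).
{ intros d Hd.
  assert (Hlim := is_lim_seq_sum_odd _ (chi4_sqr_even d) (ex_zeta_odd d Hd)).
  apply (is_lim_seq_ext _ _ _ (chi4_sqr_odd_sum d)) in Hlim.
  assert (H2 : is_lim_seq (fun N => 2 * d * sum_f_R0 (fun k => npow d (2 * k + 1)) N)
    (2 * d * zeta_odd d)) by exact (is_lim_seq_scal_l _ (2 * d) _ Hlim).
  assert (Hup : forall N, 2 * d * sum_f_R0 (fun k => npow d (2 * k + 1)) N <= 1 + 2 * d)
    by (intros N; generalize (proj1 (npow_odd_sum_bounds d N Hd)); lra).
  assert (Hexp : is_lim_seq (fun N => 1 - exp (- (d * ln (INR (2 * N + 3))))) (1 - 0)).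
  { apply is_lim_seq_minus_R; [apply is_lim_seq_const |].
    apply is_lim_seq_exp_m_infty; [exact Hd |].
    apply (is_lim_seq_subseq (fun n => ln (INR (n + 3))) p_infty (fun N => (2 * N)%nat));
      [apply eventually_subseq; intros; lia | apply is_lim_seq_ln_INR]. }
  assert (L1 := is_lim_seq_le _ _ _ _ (fun N => proj2 (npow_odd_sum_bounds d N Hd)) Hexp H2).
  assert (L2 := is_lim_seq_le _ _ _ _ Hup H2 (is_lim_seq_const _)).
  simpl in L1, L2; lra. }
intros u Hu Hu0.
apply is_lim_seq_le_le with (u := fun _ => / 2) (w := fun n => / 2 + u n).
- intros n; apply H, Hu.
- apply is_lim_seq_const.
- replace (/ 2) with (/ 2 + 0) at 1 by ring.
  apply is_lim_seq_plus'; [apply is_lim_seq_const | exact Hu0].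
Qed.

Lemma cm_chi4_sqr (d : R) : 0 < d -> summable_multiplicative (fun n => chi4 n ^ 2 * npow d n).
Proof.
intros Hd; split.
- rewrite chi4_0; ring.
- rewrite npow_1; unfold chi4; simpl; ring.
- intros a b; rewrite chi4_mul.
  destruct (Nat.eq_dec a 0) as [->|Ha]; [rewrite chi4_0; ring |].
  destruct (Nat.eq_dec b 0) as [->|Hb]; [rewrite chi4_0; ring |].
  rewrite npow_mul by lia; ring.
- apply ex_series_ext with (2 := ex_zeta_odd d Hd).
  intros n; rewrite Rabs_pos_eq; [reflexivity | apply chi4_sqr_npow_pos].
Qed.

Lemma cm_chi4 (d : R) : 0 < d -> summable_multiplicative (fun n => chi4 n * npow d n).
Proof.
intros Hd; split.
- rewrite chi4_0; ring.
- rewrite npow_1; unfold chi4; simpl; ring.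
- intros a b; rewrite chi4_mul.
  destruct (Nat.eq_dec a 0) as [->|Ha]; [rewrite chi4_0; ring |].
  destruct (Nat.eq_dec b 0) as [->|Hb]; [rewrite chi4_0; ring |].
  rewrite npow_mul by lia; ring.
- apply ex_series_dominated with (2 := ex_zeta_odd d Hd).
  intros n; rewrite Rabs_Rabsolu, Rabs_mult, (Rabs_pos_eq (npow d n)) by (left; apply npow_pos).
  destruct (chi4_cases n) as [->|[->| ->]];
    [rewrite Rabs_R0 | rewrite Rabs_R1 | rewrite Rabs_m1]; right; ring.
Qed.

Lemma is_lim_seq_npow (u : nat -> R) (n : nat) :
  is_lim_seq u 0 -> is_lim_seq (fun k => npow (u k) n) (npow 0 n).
Proof.
intros Hu; apply (is_lim_seq_continuous (fun x => npow x n)); [| exact Hu].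
apply derivable_continuous_pt; unfold npow; reg.
Qed.

Lemma npow_0 (n : nat) : (1 <= n)%nat -> npow 0 n = / INR n.
Proof.
intros Hn; unfold npow; rewrite Rplus_0_r, Rmult_1_l, exp_Ropp, exp_ln; [reflexivity |].
apply lt_0_INR; lia.
Qed.

(** At [d = 0] the convergence is only conditional, so [tannery] does not apply. Instead,
    consecutive partial sums of the alternating series bracket [L_chi4 d] for every [d > 0]; each is
    continuous in [d], and at 0 they are those of Leibniz's series for [PI / 4]. *)
Lemma L_chi4_limit : at_zero L_chi4 (PI / 4).
Proof.
set (T := fun d => sum_f_R0 (tg_alt (fun k => npow d (2 * k + 1)))).
assert (Hb : forall d N, 0 < d -> T d (S (2 * N)) <= L_chi4 d <= T d (2 * N)%nat).
{ intros d N Hd; apply alternated_series_ineq.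
  - intros k; apply npow_decr; [lra | lia].
  - apply is_lim_seq_Reals.
    apply (is_lim_seq_subseq (npow d) 0 (fun k => (2 * k + 1)%nat));
      [apply eventually_subseq; intros; lia |].
    apply is_lim_seq_exp_m_infty; [lra |].
    apply is_lim_seq_ext with (2 := is_lim_seq_ln_INR 0); intros n; rewrite Nat.add_0_r; reflexivity.
  - apply is_lim_seq_Reals.
    apply is_lim_seq_ext with
      (fun N => sum_f_R0 (fun k => chi4 (2 * k + 1) * npow d (2 * k + 1)) N).
    + intros M; apply sum_eq; intros k _; rewrite chi4_odd; reflexivity.
    + apply (is_lim_seq_sum_odd (fun n => chi4 n * npow d n)).
      * intros k; rewrite chi4_even; ring.
      * apply ex_series_Rabs, (cm_chi4 d Hd). }
assert (Hcont : forall u N, is_lim_seq u 0 -> is_lim_seq (fun k => T (u k) N) (T 0 N)).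
{ intros u N Hu.
  apply (is_lim_seq_sum_f_R0 (fun k => tg_alt (fun j => npow (u k) (2 * j + 1)))); intros n.
  exact (is_lim_seq_scal_l _ _ _ (is_lim_seq_npow u (2 * n + 1) Hu)). }
assert (H0 : is_lim_seq (T 0) (PI / 4)).
{ rewrite <- Alt_PI_eq; unfold Alt_PI; destruct exist_PI as [a Ha].
  replace (4 * a / 4) with a by field.
  apply is_lim_seq_Reals in Ha; apply is_lim_seq_ext with (2 := Ha).
  intros N; apply sum_eq; intros k _; unfold tg_alt, PI_tg; rewrite npow_0 by lia; reflexivity. }
intros u Hu Hu0; apply is_lim_seq_eps; intros eps He.
destruct (proj1 (is_lim_seq_eps _ _) H0 (eps / 2) ltac:(lra)) as [N HN].
destruct (proj1 (is_lim_seq_eps _ _) (Hcont u (2 * N)%nat Hu0) (eps / 2) ltac:(lra)) as [K1 HK1].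
destruct (proj1 (is_lim_seq_eps _ _) (Hcont u (S (2 * N)) Hu0) (eps / 2) ltac:(lra)) as [K2 HK2].
exists (K1 + K2)%nat; intros k Hk.
specialize (HK1 k ltac:(lia)); specialize (HK2 k ltac:(lia)); specialize (Hb (u k) N (Hu k)).
assert (HN1 := HN (2 * N)%nat ltac:(lia)); assert (HN2 := HN (S (2 * N)) ltac:(lia)).
apply Rabs_lt_between in HK1; apply Rabs_lt_between in HK2.
apply Rabs_lt_between in HN1; apply Rabs_lt_between in HN2.
apply Rabs_lt_between; lra.
Qed.

(** * Primes congruent to 3 modulo 4 *)

Definition euler_prod (g : nat -> R) : nat -> R :=
  prod_upto (fun p => if primeb p then 1 - g p else 1).

Lemma prod_upto_pos (f : nat -> R) (n : nat) : (forall k, 0 < f k) -> 0 < prod_upto f n.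
Proof.
intros H; induction n as [|n IH]; simpl; [apply H | apply Rmult_lt_0_compat; auto].
Qed.

Lemma prod_upto_ln (f : nat -> R) (n : nat) : (forall k, 0 < f k) ->
  ln (prod_upto f n) = sum_f_R0 (fun k => ln (f k)) n.
Proof.
intros H; induction n as [|n IH]; simpl; [reflexivity |].
rewrite ln_mult, IH by auto using prod_upto_pos; reflexivity.
Qed.

Lemma euler_factor_pos (chi : nat -> R) (d : R) (p : nat) : 0 < d ->
  (forall n, Rabs (chi n) <= 1) -> 0 < if primeb p then 1 - chi p * npow d p else 1.
Proof.
intros Hd Hchi; destruct (primeb p) eqn:Hp; [| lra].
apply primeb_spec, prime_ge_2 in Hp.
assert (H2 := npow_le_half d p ltac:(lra) ltac:(lia)); assert (H0 := npow_pos d p).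
specialize (Hchi p); apply Rabs_le_between in Hchi; nra.
Qed.

Lemma euler_product_ln (chi : nat -> R) (d : R) : 0 < d ->
  (forall n, Rabs (chi n) <= 1) -> summable_multiplicative (fun n => chi n * npow d n) ->
  let s := Series (fun n => chi n * npow d n) in
  0 < s /\ is_lim_seq (fun k => ln (euler_prod (fun n => chi n * npow d n) k)) (- ln s).
Proof.
intros Hd Hchi Hcm s; assert (H := euler_product _ Hcm); fold s in H.
fold (euler_prod (fun n => chi n * npow d n)) in H.
assert (Hp : forall k, 0 < euler_prod (fun n => chi n * npow d n) k)
  by (intros k; apply prod_upto_pos; intros p; apply euler_factor_pos; assumption).
(* The partial products are positive, so with [s <= 0] their products with [s] could not tend to
   1. *)
assert (Hs : 0 < s).
{ apply Rnot_le_lt; intros Hs.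
  assert (Hle := is_lim_seq_le _ (fun _ => 0) _ 0
    (fun k => Rmult_le_0_l _ _ (Rlt_le _ _ (Hp k)) Hs) H (is_lim_seq_const 0)).
  simpl in Hle; lra. }
split; [exact Hs |].
apply is_lim_seq_ext with
  (fun k => ln (euler_prod (fun n => chi n * npow d n) k * s) - ln s).
- intros k; rewrite ln_mult by auto; ring.
- replace (- ln s) with (ln 1 - ln s) by (rewrite ln_1; ring).
  apply is_lim_seq_minus_R; [| apply is_lim_seq_const].
  apply (is_lim_seq_continuous ln); [| exact H].
  apply derivable_continuous_pt; exists (/ 1); apply derivable_pt_lim_ln; lra.
Qed.

Definition phi (t : R) : R := ln (1 + t) - ln (1 - t).

Definition p3_indicator (f : nat -> R) (n : nat) : R := if is_prime3mod4 n then f n else 0.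

Lemma Rabs_chi4_le (n : nat) : Rabs (chi4 n) <= 1.
Proof.
destruct (chi4_cases n) as [->|[->| ->]]; [rewrite Rabs_R0 | rewrite Rabs_R1 | rewrite Rabs_m1]; lra.
Qed.

Lemma Rabs_chi4_sqr_le (n : nat) : Rabs (chi4 n ^ 2) <= 1.
Proof.
destruct (chi4_cases n) as [->|[->| ->]]; apply Rabs_le_between; lra.
Qed.

Lemma is_prime3mod4_primeb (n : nat) : is_prime3mod4 n = primeb n && (n mod 4 =? 3)%nat.
Proof. reflexivity. Qed.

(** At primes 1 modulo 4 the two Euler factors coincide, and at 2 both are 1. *)
Lemma p3_phi_euler_factors (d : R) (n : nat) : 0 < d ->
  ln (if primeb n then 1 - chi4 n * npow d n else 1) -
  ln (if primeb n then 1 - chi4 n ^ 2 * npow d n else 1) =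
  p3_indicator (fun n => phi (npow d n)) n.
Proof.
intros Hd; unfold p3_indicator; rewrite is_prime3mod4_primeb.
destruct (primeb n); cbn [andb]; [| exact (Rminus_diag (ln 1))].
unfold chi4; destruct (n mod 4)%nat as [|[|[|[|x]]]]; simpl Nat.eqb; cbv iota;
  try (replace (0 ^ 2) with 0 by ring; exact (Rminus_diag _)).
- replace (1 ^ 2) with 1 by ring; exact (Rminus_diag _).
- unfold phi; replace ((-1) ^ 2) with 1 by ring; rewrite Rmult_1_l.
  replace (1 - -1 * npow d n) with (1 + npow d n) by ring; reflexivity.
Qed.

Lemma p3_phi_series (d : R) : 0 < d ->
  0 < zeta_odd d /\ 0 < L_chi4 d /\
  is_series (p3_indicator (fun n => phi (npow d n))) (ln (zeta_odd d) - ln (L_chi4 d)).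
Proof.
intros Hd.
destruct (euler_product_ln _ d Hd Rabs_chi4_sqr_le (cm_chi4_sqr d Hd)) as [Z0 HZ].
destruct (euler_product_ln _ d Hd Rabs_chi4_le (cm_chi4 d Hd)) as [L0 HL].
fold (zeta_odd d) in Z0, HZ; fold (L_chi4 d) in L0, HL.
split; [exact Z0 |]; split; [exact L0 |].
assert (H := is_lim_seq_minus_R _ _ _ _ HL HZ).
replace (- ln (L_chi4 d) - - ln (zeta_odd d)) with (ln (zeta_odd d) - ln (L_chi4 d)) in H by ring.
apply is_lim_seq_ext with (2 := H); intros n.
unfold euler_prod; rewrite !prod_upto_ln.
2: intros k; apply (euler_factor_pos (fun n => chi4 n ^ 2)); [exact Hd | apply Rabs_chi4_sqr_le].
2: intros k; apply euler_factor_pos; [exact Hd | apply Rabs_chi4_le].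
rewrite <- minus_sum, sum_n_Reals.
apply sum_eq; intros k _; apply p3_phi_euler_factors, Hd.
Qed.

(** * Near-linearity of [phi] and the error it causes *)

Lemma ln_le_minus_1 (x : R) : 0 < x -> ln x <= x - 1.
Proof. intros Hx; generalize (exp_ineq1_le (ln x)); rewrite exp_ln by exact Hx; lra. Qed.

Lemma ln_ge_1_minus_inv (x : R) : 0 < x -> 1 - / x <= ln x.
Proof.
intros Hx; generalize (ln_le_minus_1 (/ x) (Rinv_0_lt_compat _ Hx)).
rewrite ln_Rinv by exact Hx; lra.
Qed.

Lemma phi_approx (t : R) : 0 <= t <= / 2 -> Rabs (phi t - 2 * t) <= 2 * t ^ 2.
Proof.
intros Ht; unfold phi.
assert (H1 := ln_le_minus_1 (1 + t) ltac:(lra)).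
assert (H2 := ln_ge_1_minus_inv (1 + t) ltac:(lra)).
assert (H3 := ln_le_minus_1 (1 - t) ltac:(lra)).
assert (H4 := ln_ge_1_minus_inv (1 - t) ltac:(lra)).
assert (H5 : / (1 + t) <= 1 - t + t ^ 2).
{ apply Rmult_le_reg_l with (1 + t); [lra |]; rewrite Rinv_r by lra.
  assert (0 <= t ^ 3) by (apply pow_le; lra); lra. }
assert (H6 : / (1 - t) <= 1 + t + 2 * t ^ 2).
{ apply Rmult_le_reg_l with (1 - t); [lra |]; rewrite Rinv_r by lra.
  assert (0 <= t ^ 2 * (1 - 2 * t)) by (apply Rmult_le_pos; [apply pow2_ge_0 | lra]); lra. }
assert (0 <= t ^ 2) by apply pow2_ge_0.
apply Rabs_le_between; lra.
Qed.

Lemma phi_nonneg (t : R) : 0 <= t < 1 -> 0 <= phi t.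
Proof. intros Ht; unfold phi; assert (ln (1 - t) <= ln (1 + t)) by (apply ln_le; lra); lra. Qed.

(** Both terms are within [2 * t ^ 2] of [2 * t * q]. With [t = 1/p] and [q = p^-d] this trades
    phi(p^-(1+d)), which the Euler products give, for phi(1/p) p^-d, a Laplace term whose weight is
    free of [d]. *)
Lemma phi_scal_approx (t q : R) : 0 <= t <= / 2 -> 0 <= q <= 1 ->
  Rabs (phi (t * q) - phi t * q) <= 4 * t ^ 2.
Proof.
intros Ht Hq.
assert (Htq : 0 <= t * q <= t) by nra.
assert (H1 := phi_approx (t * q) ltac:(lra)); assert (H2 := phi_approx t Ht).
assert (0 <= t ^ 2) by apply pow2_ge_0.
assert (H3 : (t * q) ^ 2 <= t ^ 2) by (apply pow_incr; lra).
apply Rabs_le_between in H1; apply Rabs_le_between in H2.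
apply Rabs_le_between; nra.
Qed.

Definition p3_weight (n : nat) : R := p3_indicator (fun n => phi (/ INR n)) n.

Lemma npow_split (d : R) (n : nat) : (1 <= n)%nat ->
  npow d n = / INR n * exp (- (d * ln (INR n))).
Proof.
intros Hn; rewrite <- npow_0 by exact Hn; unfold npow; rewrite <- exp_plus; f_equal; ring.
Qed.

Lemma is_prime3mod4_spec (n : nat) : is_prime3mod4 n = true ->
  (3 <= n)%nat /\ chi4 n = -1.
Proof.
rewrite is_prime3mod4_primeb, andb_true_iff, primeb_spec, Nat.eqb_eq.
intros [Hp H3]; split; [| unfold chi4; rewrite H3; reflexivity].
generalize (Nat.Div0.mod_le n 4); lia.
Qed.

Lemma inv_INR_bounds (n : nat) : (2 <= n)%nat -> 0 < / INR n <= / 2.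
Proof.
intros Hn; assert (2 <= INR n) by (apply (le_INR 2); lia).
split; [apply Rinv_0_lt_compat; lra | apply Rinv_le_contravar; lra].
Qed.

Lemma p3_weight_nonneg (n : nat) : 0 <= p3_weight n.
Proof.
unfold p3_weight, p3_indicator; destruct (is_prime3mod4 n) eqn:Hn; [| lra].
apply is_prime3mod4_spec in Hn; apply phi_nonneg.
generalize (inv_INR_bounds n ltac:(lia)); lra.
Qed.

Definition p3_error (d : R) (n : nat) : R :=
  p3_indicator (fun n => phi (npow d n)) n - p3_weight n * exp (- (d * ln (INR n))).

(** The majorant is [4 / n ^ 2] on odd [n], written as a term of [zeta_odd 1] so that [ex_zeta_odd]
    gives its summability; it does not depend on [d]. *)
Lemma p3_error_bound (d : R) (n : nat) : 0 < d ->
  Rabs (p3_error d n) <= 4 * (chi4 n ^ 2 * npow 1 n).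
Proof.
intros Hd; unfold p3_error, p3_weight, p3_indicator; destruct (is_prime3mod4 n) eqn:Hn.
- apply is_prime3mod4_spec in Hn; destruct Hn as [Hn Hc].
  assert (Hi := inv_INR_bounds n ltac:(lia)); assert (Hl := ln_INR_pos n ltac:(lia)).
  rewrite npow_split by lia.
  apply Rle_trans with (4 * (/ INR n) ^ 2).
  + apply phi_scal_approx; [lra |].
    generalize (exp_neg_bounds (d * ln (INR n)) ltac:(nra)); lra.
  + right; rewrite Hc, npow_split, Rmult_1_l, exp_Ropp, exp_ln by (lia || apply lt_0_INR; lia).
    ring.
- rewrite Rmult_0_l, Rminus_0_r, Rabs_R0.
  generalize (chi4_sqr_npow_pos 1 n); lra.
Qed.

Lemma ex_p3_error (d : R) : 0 < d -> ex_series (p3_error d).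
Proof.
intros Hd; apply ex_series_dominated with (1 := fun n => p3_error_bound d n Hd).
exact (ex_series_scal 4 _ (ex_zeta_odd 1 Rlt_0_1)).
Qed.

Lemma p3_error_limit : at_zero (fun d => Series (p3_error d)) 0.
Proof.
intros u Hu Hu0.
replace (Finite 0) with (Finite (Series (fun _ => 0))).
2: { f_equal; apply is_series_unique, is_series_Reals; intros e He; exists 0%nat; intros n _.
     rewrite sum_eq_R0 by reflexivity; rewrite R_dist_eq; exact He. }
apply tannery with (b := fun n => 4 * (chi4 n ^ 2 * npow 1 n)).
- intros k n; apply p3_error_bound, Hu.
- exact (ex_series_scal 4 _ (ex_zeta_odd 1 Rlt_0_1)).
- intros n; unfold p3_error, p3_weight, p3_indicator; destruct (is_prime3mod4 n) eqn:Hn.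
  + apply is_prime3mod4_spec in Hn.
    assert (Hi := inv_INR_bounds n ltac:(lia)).
    replace 0 with (phi (npow 0 n) - phi (/ INR n) * 1) by (rewrite npow_0 by lia; ring).
    apply is_lim_seq_minus_R.
    * apply (is_lim_seq_continuous phi); [| apply is_lim_seq_npow, Hu0].
      rewrite npow_0 by lia; apply continuity_pt_filterlim, (ex_derive_continuous phi).
      unfold phi; auto_derive; lra.
    * apply (is_lim_seq_scal_l _ _ 1).
      rewrite <- exp_0; apply (is_lim_seq_continuous exp);
        [apply derivable_continuous, derivable_exp |].
      apply is_lim_seq_ext with (fun k => - ln (INR n) * u k); [intros k; ring |].
      apply is_lim_seq_scal_0, Hu0.
  + apply is_lim_seq_ext with (fun _ => 0); [intros k; ring | apply is_lim_seq_const].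
Qed.

Lemma p3_laplace (d : R) : 0 < d ->
  is_series (fun n => p3_weight n * exp (- (d * ln (INR n))))
    (ln (zeta_odd d) - ln (L_chi4 d) - Series (p3_error d)).
Proof.
intros Hd; destruct (p3_phi_series d Hd) as [_ [_ H]].
assert (H2 := is_series_minus _ _ _ _ H (Series_correct _ (ex_p3_error d Hd))).
apply is_series_ext with (2 := H2).
intros n; unfold p3_error, minus, plus, opp; simpl; ring.
Qed.

(** The indices 0 and 1 carry no weight and are dropped because [ln n] is positive only from 2 on.
    The constant is ln (1/2) - ln (PI / 4), from the residue of [zeta_odd] and the limit of
    [L_chi4]. *)
Lemma p3_log_laplace :
  log_laplace (fun n => p3_weight (2 + n)) (fun n => ln (INR (2 + n))) (ln (2 / PI)).
Proof.
assert (Hsh : forall d, 0 < d -> is_series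
  (fun n => p3_weight (2 + n) * exp (- (d * ln (INR (2 + n)))))
    (ln (zeta_odd d) - ln (L_chi4 d) - Series (p3_error d))).
{ intros d Hd; assert (H := p3_laplace d Hd).
  assert (Hex : ex_series (fun n => p3_weight n * exp (- (d * ln (INR n))))) by (eexists; exact H).
  assert (H0 : forall n, (n < 2)%nat -> p3_weight n = 0).
  { intros n Hn; unfold p3_weight, p3_indicator.
    rewrite is_prime3mod4_primeb, primeb_lt_2 by exact Hn; reflexivity. }
  rewrite <- (is_series_unique _ _ H), (Series_incr_n _ 2) by (lia || exact Hex).
  simpl Init.Nat.pred; rewrite tech5; simpl sum_f_R0; rewrite !H0, !Rmult_0_l, !Rplus_0_l by lia.
  apply Series_correct, (ex_series_incr_n (fun n => p3_weight n * exp (- (d * ln (INR n)))) 2), Hex. }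
split.
- intros n; apply p3_weight_nonneg.
- intros n; apply ln_INR_pos; lia.
- intros m n Hmn; apply ln_INR_le; lia.
- apply is_lim_seq_ext with (2 := is_lim_seq_ln_INR 2); intros n; rewrite Nat.add_comm; reflexivity.
- intros d Hd; eexists; apply Hsh, Hd.
- assert (HPI := PI_RGT_0).
  intros u Hu Hu0.
  apply is_lim_seq_ext with
    (fun n => ln (u n * zeta_odd (u n)) - ln (L_chi4 (u n)) - Series (p3_error (u n))).
  + intros n; unfold laplace; rewrite (is_series_unique _ _ (Hsh (u n) (Hu n))).
    rewrite ln_mult by (apply Hu || apply p3_phi_series, Hu); ring.
  + replace (ln (2 / PI)) with (ln (/ 2) - ln (PI / 4) - 0).
    * apply is_lim_seq_minus_R; [| apply p3_error_limit; assumption].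
      apply is_lim_seq_minus_R; apply (is_lim_seq_continuous ln);
        try (apply zeta_odd_residue || apply L_chi4_limit; assumption);
        apply derivable_continuous_pt; eexists; apply derivable_pt_lim_ln; lra.
    * replace (2 / PI) with (/ 2 * / (PI / 4)) by (field; lra).
      rewrite ln_mult, (ln_Rinv (PI / 4)) by (lra || apply Rinv_0_lt_compat; lra); ring.
Qed.

(** * The harmonic measure *)

(** The derivative of the sum plus logarithm is the geometric remainder [- t ^ (N + 1) / (1 - t)];
    the mean value theorem on [[0, x]] then gives the bound, as [x < 1]. *)
Lemma log_series_partial (x : R) (N : nat) : 0 < x < 1 ->
  Rabs (sum_f_R0 (fun n => / INR (n + 1) * x ^ (n + 1)) N + ln (1 - x)) <=
  x ^ (N + 1) / (1 - x).
Proof.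
intros Hx.
set (h := fun t => sum_f_R0 (fun n => / INR (n + 1) * t ^ (n + 1)) N + ln (1 - t)).
assert (Hsum : forall t, is_derive (fun t => sum_f_R0 (fun n => / INR (n + 1) * t ^ (n + 1)) N) t
  (sum_f_R0 (fun n => t ^ n) N)).
{ intros t.
  assert (Hm : forall n, is_derive (fun t => / INR (n + 1) * t ^ (n + 1)) t (t ^ n)).
  { intros n; auto_derive; [exact I |].
    replace (Nat.pred (n + 1)) with n by lia.
    field; apply not_0_INR; lia. }
  induction N as [|M IH]; [apply (Hm 0%nat) |].
  exact (is_derive_plus _ _ t _ _ IH (Hm (S M))). }
destruct (MVT_cor2 h (fun t => sum_f_R0 (fun n => t ^ n) N - / (1 - t)) 0 x) as [c [Hc1 Hc2]];
  [lra | |].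
- intros c Hc; apply is_derive_Reals; unfold h.
  apply (is_derive_plus (fun t => sum_f_R0 (fun n => / INR (n + 1) * t ^ (n + 1)) N)
    (fun t => ln (1 - t)) c _ (- / (1 - c)) (Hsum c)).
  auto_derive; [lra | field; lra].
- assert (H0 : h 0 = 0).
  { unfold h; rewrite sum_eq_R0 by (intros n _; rewrite pow_i by lia; ring).
    rewrite Rminus_0_r, ln_1; ring. }
  fold (h x); rewrite H0, !Rminus_0_r in Hc1; rewrite Hc1.
  rewrite tech3 by lra.
  replace ((1 - c ^ S N) / (1 - c) - / (1 - c)) with (- (c ^ S N / (1 - c))) by (field; lra).
  assert (Hcp : 0 <= c ^ S N) by (apply pow_le; lra).
  assert (Hxp : c ^ S N <= x ^ S N) by (apply pow_incr; lra).
  assert (Hi : / (1 - c) <= / (1 - x)) by (apply Rinv_le_contravar; lra).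
  assert (Hi0 : 0 < / (1 - c)) by (apply Rinv_0_lt_compat; lra).
  assert (Hq : 0 <= c ^ S N / (1 - c)) by (apply Rmult_le_pos; lra).
  rewrite Rabs_mult, Rabs_Ropp, !Rabs_pos_eq by lra.
  apply Rle_trans with (c ^ S N / (1 - c) * 1); [apply Rmult_le_compat_l; lra |].
  rewrite Rmult_1_r, Nat.add_1_r; apply Rmult_le_compat; lra.
Qed.

Lemma is_series_log (x : R) : 0 < x < 1 ->
  is_series (fun n => / INR (n + 1) * x ^ (n + 1)) (- ln (1 - x)).
Proof.
intros Hx.
assert (Hg : is_lim_seq (fun N => x ^ (N + 1) / (1 - x)) 0).
{ apply is_lim_seq_ext with (fun N => / (1 - x) * x ^ (N + 1)); [intros; unfold Rdiv; ring |].
  apply is_lim_seq_scal_0.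
  apply (is_lim_seq_incr_n (fun N => x ^ N) 1), is_lim_seq_geom.
  rewrite Rabs_pos_eq; lra. }
apply is_series_Reals; intros e He.
destruct (proj1 (is_lim_seq_eps _ _) Hg e He) as [N HN].
exists N; intros n Hn; specialize (HN n Hn); unfold R_dist.
replace (sum_f_R0 (fun n => / INR (n + 1) * x ^ (n + 1)) n - - ln (1 - x)) with
  (sum_f_R0 (fun n => / INR (n + 1) * x ^ (n + 1)) n + ln (1 - x)) by ring.
apply Rle_lt_trans with (1 := log_series_partial x n Hx).
rewrite Rminus_0_r in HN; generalize (Rle_abs (x ^ (n + 1) / (1 - x))); lra.
Qed.

(** The transform is [- ln (1 - exp (- d))], and the constant is 0 because [(1 - exp (- d)) / d]
    tends to 1. *)
Lemma harmonic_log_laplace :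
  log_laplace (fun n => / INR (S n)) (fun n => INR (S n)) 0.
Proof.
assert (Hs : forall d, 0 < d -> is_series (fun n => / INR (S n) * exp (- (d * INR (S n))))
  (- ln (1 - exp (- d)))).
{ intros d Hd.
  assert (Hx : 0 < exp (- d) < 1)
    by (split; [apply exp_pos | rewrite <- exp_0; apply exp_increasing; lra]).
  apply is_series_ext with (2 := is_series_log _ Hx).
  intros n; rewrite Nat.add_1_r, exp_pow; do 2 f_equal; ring. }
split.
- intros n; left; apply Rinv_0_lt_compat, lt_0_INR; lia.
- intros n; apply lt_0_INR; lia.
- intros m n Hmn; apply le_INR; lia.
- apply (is_lim_seq_incr_1 INR), is_lim_seq_INR.
- intros d Hd; eexists; apply Hs, Hd.
- intros u Hu Hu0.
  apply is_lim_seq_ext with (fun n => - ln ((1 - exp (- u n)) / u n)).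
  + intros n; unfold laplace; rewrite (is_series_unique _ _ (Hs _ (Hu n))).
    assert (exp (- u n) < 1) by (rewrite <- exp_0; apply exp_increasing; generalize (Hu n); lra).
    unfold Rdiv; rewrite ln_mult, ln_Rinv; [ring | apply Hu | lra | apply Rinv_0_lt_compat, Hu].
  + replace (Finite 0) with (Rbar_opp (ln 1)) by (simpl; rewrite ln_1, Ropp_0; reflexivity).
    apply -> is_lim_seq_opp.
    apply (is_lim_seq_continuous ln);
      [apply derivable_continuous_pt; eexists; apply derivable_pt_lim_ln; lra |].
    apply is_lim_seq_le_le with (u := fun n => 1 - u n) (w := fun _ => 1).
    * intros n; assert (H := Hu n).
      assert (H1 := exp_ineq1_le (- u n)); assert (H2 := exp_ineq1_le (u n)).
      assert (H3 : exp (- u n) <= / (1 + u n))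
        by (rewrite exp_Ropp; apply Rinv_le_contravar; lra).
      split; apply Rmult_le_reg_r with (u n); try exact H;
        unfold Rdiv; rewrite Rmult_assoc, Rinv_l, ?Rmult_1_r by lra; [| lra].
      assert (H4 : / (1 + u n) <= 1 - u n + u n ^ 2).
      { apply Rmult_le_reg_l with (1 + u n); [lra |]; rewrite Rinv_r by lra.
        assert (0 <= u n ^ 3) by (apply pow_le; lra); lra. }
      lra.
    * replace 1 with (1 - 0) at 1 by ring.
      apply is_lim_seq_minus_R; [apply is_lim_seq_const | exact Hu0].
    * apply is_lim_seq_const.
Qed.

(** * Conclusion *)

Lemma sqrt_exp (y : R) : sqrt (exp y) = exp (y / 2).
Proof.
replace y with (y / 2 + y / 2) at 1 by field.
rewrite exp_plus; apply sqrt_square; left; apply exp_pos.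
Qed.

Lemma p3_factor_split (t : R) : 0 < t <= / 2 ->
  / (1 + t) = / sqrt (1 - t ^ 2) * exp (- phi t / 2).
Proof.
intros Ht.
replace (1 - t ^ 2) with (exp (ln (1 + t) + ln (1 - t)))
  by (rewrite exp_plus, !exp_ln by lra; ring).
rewrite sqrt_exp, <- exp_Ropp, <- exp_plus; unfold phi.
replace (- ((ln (1 + t) + ln (1 - t)) / 2) + - (ln (1 + t) - ln (1 - t)) / 2)
  with (- ln (1 + t)) by field.
rewrite exp_Ropp, exp_ln by lra; reflexivity.
Qed.

Lemma prod_upto_S (f : nat -> R) (n : nat) : prod_upto f (S n) = prod_upto f n * f (S n).
Proof. reflexivity. Qed.

Lemma median_prod_split (n : nat) :
  prod_upto (factor3 (fun x => / (1 + / x))) n =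
  prod_upto (factor3 (fun x => / sqrt (1 - / (x ^ 2)))) n * exp (- sum_f_R0 p3_weight n / 2).
Proof.
assert (H : forall k, factor3 (fun x => / (1 + / x)) k =
  factor3 (fun x => / sqrt (1 - / (x ^ 2))) k * exp (- p3_weight k / 2)).
{ intros k; unfold factor3, p3_weight, p3_indicator.
  destruct (is_prime3mod4 k) eqn:Hk.
  - apply is_prime3mod4_spec in Hk.
    rewrite (p3_factor_split (/ INR k)) by (apply inv_INR_bounds; lia).
    rewrite pow_inv; reflexivity.
  - replace (- 0 / 2) with 0 by field; rewrite exp_0; ring. }
induction n as [|n IH]; [apply H |].
rewrite tech5, !prod_upto_S, H, IH.
replace (- (sum_f_R0 p3_weight n + p3_weight (S n)) / 2)
  with (- sum_f_R0 p3_weight n / 2 + - p3_weight (S n) / 2) by field.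
rewrite exp_plus; ring.
Qed.

Lemma prod_upto_ge_1 (f : nat -> R) (n : nat) : (forall k, 1 <= f k) -> 1 <= prod_upto f n.
Proof.
intros H; induction n as [|n IH]; simpl; [apply H |].
generalize (H (S n)); nra.
Qed.

(** Every factor of the product is at least 1, so the limit is at least [/ sqrt 2]. *)
Lemma beta_pos (beta : R) : Un_cv beta_partial beta -> 0 < beta.
Proof.
intros H; apply is_lim_seq_Reals in H.
assert (H2 : 0 < / sqrt 2) by (apply Rinv_0_lt_compat, sqrt_lt_R0; lra).
apply Rlt_le_trans with (1 := H2).
apply (is_lim_seq_le (fun _ => / sqrt 2) beta_partial (/ sqrt 2) beta);
  [| apply is_lim_seq_const | exact H].
intros n; unfold beta_partial; rewrite <- (Rmult_1_r (/ sqrt 2)) at 1.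
apply Rmult_le_compat_l; [lra |]; apply prod_upto_ge_1; intros k; unfold factor3.
destruct (is_prime3mod4 k) eqn:Hk; [| lra].
apply is_prime3mod4_spec in Hk.
assert (Hi := inv_INR_bounds k ltac:(lia)).
rewrite <- pow_inv, <- Rinv_1; apply Rinv_le_contravar.
- apply sqrt_lt_R0; nra.
- rewrite Rinv_1; rewrite <- sqrt_1 at 2; apply sqrt_le_1_alt; nra.
Qed.

Lemma ratio_split (beta : R) (n : nat) : 0 < beta -> (2 <= n)%nat ->
  M n / L beta n = beta_partial n * (sqrt 2 / 2 / beta) *
    exp ((ln (ln (INR n)) - sum_f_R0 p3_weight n) / 2).
Proof.
intros Hb Hn; assert (Hl := ln_INR_pos n Hn).
assert (Hs : sqrt (ln (INR n)) = exp (ln (ln (INR n)) / 2))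
  by (rewrite <- sqrt_exp, exp_ln by exact Hl; reflexivity).
assert (H2 : 0 < sqrt 2) by (apply sqrt_lt_R0; lra).
unfold M, L, beta_partial; rewrite median_prod_split, Hs.
replace ((ln (ln (INR n)) - sum_f_R0 p3_weight n) / 2)
  with (ln (ln (INR n)) / 2 + - sum_f_R0 p3_weight n / 2) by field.
rewrite exp_plus; field; repeat split; try lra; apply Rgt_not_eq, exp_pos.
Qed.

(** A Mertens theorem for the class 3 modulo 4. The double logarithm arises because the primes sit
    at the points [ln p], while the harmonic masses sit at [m] itself. *)
Lemma p3_mertens (gamma : R) : Un_cv euler_partial gamma ->
  is_lim_seq (fun N => sum_f_R0 p3_weight (N + 2) - ln (ln (INR (N + 2))))
    (gamma + ln (2 / PI)).
Proof.
intros Hg; apply is_lim_seq_Reals in Hg.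
assert (Hh : is_lim_seq
  (fun N => sum_f_R0 (fun n => / INR (S n)) N - ln (INR (S N)) - 0) gamma)
  by (apply is_lim_seq_ext with (2 := Hg); intros N; unfold euler_partial; ring).
assert (H := tauber_transfer _ _ _ _ _ _ _ p3_log_laplace harmonic_log_laplace Hh).
apply is_lim_seq_ext with (fun N => sum_f_R0 (fun n => p3_weight (2 + n)) N
  - ln (ln (INR (2 + N))) - ln (2 / PI) + ln (2 / PI)).
- intros N; rewrite (Nat.add_comm N 2).
  enough (E : sum_f_R0 p3_weight (2 + N) = sum_f_R0 (fun n => p3_weight (2 + n)) N)
    by (rewrite E; ring).
  assert (H0 : forall n, (n < 2)%nat -> p3_weight n = 0).
  { intros n Hn; unfold p3_weight, p3_indicator.
    rewrite is_prime3mod4_primeb, primeb_lt_2 by exact Hn; reflexivity. }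
  induction N as [|N IH].
  + change (p3_weight 0 + p3_weight 1 + p3_weight 2 = p3_weight 2); rewrite !H0 by lia; ring.
  + change (sum_f_R0 p3_weight (2 + N) + p3_weight (2 + S N) =
      sum_f_R0 (fun n => p3_weight (2 + n)) N + p3_weight (2 + S N)); rewrite IH; reflexivity.
- apply is_lim_seq_plus'; [exact H | apply is_lim_seq_const].
Qed.

Theorem theorem4p1 (beta gamma : R)
  (Hbeta : Un_cv beta_partial beta)
  (Hgamma : Un_cv euler_partial gamma) :
  Un_cv (fun n => M n / L beta n) (/ 2 * sqrt (PI / exp gamma)).
Proof.
assert (Hb := beta_pos beta Hbeta); assert (HPI := PI_RGT_0).
apply is_lim_seq_Reals in Hbeta; apply is_lim_seq_Reals, (is_lim_seq_incr_n _ 2).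
apply is_lim_seq_ext with (fun N => beta_partial (N + 2) * (sqrt 2 / 2 / beta) *
  exp ((- / 2) * (sum_f_R0 p3_weight (N + 2) - ln (ln (INR (N + 2)))))).
- intros N; rewrite ratio_split by (lia || exact Hb); do 2 f_equal; field.
- replace (/ 2 * sqrt (PI / exp gamma)) with
    (beta * (sqrt 2 / 2 / beta) * exp ((- / 2) * (gamma + ln (2 / PI)))).
  + apply is_lim_seq_mult'.
    * apply is_lim_seq_mult'; [| apply is_lim_seq_const].
      apply (is_lim_seq_incr_n beta_partial 2), Hbeta.
    * apply (is_lim_seq_continuous exp); [apply derivable_continuous, derivable_exp |].
      exact (is_lim_seq_scal_l _ (- / 2) _ (p3_mertens gamma Hgamma)).
  (* All square roots become exponentials: the factor [sqrt 2] cancels the [ln 2] of [ln (2 / PI)],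
     and the 1/2 of [sqrt 2 / 2] remains. *)
  + assert (HPI0 : 0 < / PI) by (apply Rinv_0_lt_compat, HPI).
    assert (H2 : sqrt 2 = exp (ln 2 / 2)) by (rewrite <- sqrt_exp, exp_ln by lra; reflexivity).
    replace (PI / exp gamma) with (exp (ln PI - gamma))
      by (unfold Rminus; rewrite exp_plus, exp_ln, exp_Ropp by exact HPI; reflexivity).
    change (2 / PI) with (2 * / PI); rewrite sqrt_exp, H2, ln_mult, ln_Rinv by lra.
    replace ((ln PI - gamma) / 2) with (ln 2 / 2 + - / 2 * (gamma + (ln 2 + - ln PI))) by field.
    rewrite exp_plus; field; lra.
Qed.
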